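(* Let $n,k\ge1$ be integers and $\mathbb{X}=\{x_1,\dots,x_n\}$ a finite alphabet. Then $$\Delta(\mathbb{X})^{2k}=\frac{(-1)^{\frac{kn(n-1)}{2}}}{n!}\binom{(k+1)n}{k+1,\dots,k+1}P^{(k+1)}_{n^{(n-1)k}}(-\mathbb{X}).$$
   Context: $\Delta(\mathbb{X})=\prod_{i<j}(x_i-x_j)$; $\binom{(k+1)n}{k+1,\dots,k+1}=\frac{((k+1)n)!}{((k+1)!)^n}$; $n^{(n-1)k}$ is the rectangular partition with $(n-1)k$ parts equal to $n$ (empty if $n=1$). Evaluating a symmetric function at $-\mathbb{X}$ is meant in the $\lambda$-ring sense: each power sum $\Psi_r=\sum_i x_i^r$ is replaced by $-\Psi_r(\mathbb{X})$; equivalently $\Lambda^m(-\mathbb{X})=(-1)^mS^m(\mathbb{X})$, with $\Lambda^m$, $S^m$ the elementary and complete symmetric functions. Jack polynomials: let $\Psi_\lambda$ be the products of power sums and $\langle\Psi_\lambda,\Psi_\mu\rangle_\alpha=\delta_{\lambda\mu}z_\lambda\alpha^{\ell(\lambda)}$, where $z_\lambda=\prod_i i^{m_i(\lambda)}m_i(\lambda)!$, $m_i(\lambda)$ is the multiplicity of $i$ in $\lambda$ and $\ell(\lambda)$ the length of $\lambda$. The Jack polynomials $P_\lambda^{(\alpha)}$ are the unique symmetric functions orthogonal for $\langle\,,\rangle_\alpha$ with $P_\lambda^{(\alpha)}=m_\lambda+\sum_{\mu<\lambda}u^{(\alpha)}_{\lambda\mu}m_\mu$ ($m_\mu$ the monomial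 functions, $<$ the dominance order). *)

(* Defs.v *)
From HB Require Import structures.
From mathcomp Require Import all_boot all_order all_algebra.
(* monalg after mpoly: msupp and mmap below are those of monalg. *)
From mathcomp Require Import finmap mpoly monalg.

Set Implicit Arguments.
Unset Strict Implicit.
Unset Printing Implicit Defensive.

Import GRing.Theory.

Local Open Scope ring_scope.

Definition is_part (s : seq nat) : bool := sorted geq s && (0%N \notin s).

Record intpart : Type :=
  IntPart { parts :> seq nat; partsP : is_part parts }.

HB.instance Definition _ := [isSub for parts].
HB.instance Definition _ := [Choice of intpart by <:].

Lemma geq_trans : transitive geq.
Proof. by move=> y x z /= yx zy; exact: leq_trans zy yx. Qed.

Lemma geq_anti : antisymmetric geq.
Proof. by move=> x y; rewrite /= andbC => /anti_leq. Qed.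

Lemma geq_total : total geq.
Proof. by move=> x y; exact: leq_total. Qed.

Lemma part_perm (la mu : intpart) : perm_eq la mu -> la = mu.
Proof.
move=> pe; apply: val_inj; apply: (sorted_eq geq_trans geq_anti) pe.
  by case/andP: (partsP la).
by case/andP: (partsP mu).
Qed.

Fact is_part_nil : is_part [::].
Proof. by []. Qed.

Fact is_part_cup (la mu : intpart) : is_part (sort geq (la ++ mu)).
Proof.
apply/andP; split; first exact: sort_sorted geq_total _.
rewrite mem_sort mem_cat negb_or.
by case/andP: (partsP la) => _ ->; case/andP: (partsP mu).
Qed.

Fact is_part_rect (m a : nat) : is_part (nseq (a.-1 * m) a).
Proof.
apply/andP; split; last by case: a => [|a]; rewrite ?mem_nseq ?andbF.
elim: (a.-1 * m)%N => //= l; case: l => //= l ->.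
by rewrite /geq /= leqnn.
Qed.

(* The partition n^((n-1)k). *)
Definition rect_part (n k : nat) : intpart := IntPart (is_part_rect k n).

Definition part0 : intpart := IntPart is_part_nil.

Definition part_cup (la mu : intpart) : intpart :=
  IntPart (is_part_cup la mu).

Lemma perm_cup (la mu : intpart) : perm_eq (part_cup la mu) (la ++ mu).
Proof. by rewrite perm_sort. Qed.

Fact part_cupC : commutative part_cup.
Proof.
move=> a b; apply: part_perm.
by rewrite (permPl (perm_cup _ _)) perm_sym (permPl (perm_cup _ _)) perm_catC.
Qed.

Fact part_cupA : associative part_cup.
Proof.
move=> a b c; apply: part_perm.
apply: (@perm_trans _ (a ++ (b ++ c))).
  by rewrite (permPl (perm_cup _ _)) perm_cat2l perm_cup.
by rewrite perm_sym (permPl (perm_cup _ _)) catA perm_cat2r perm_cup.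
Qed.

Fact part_cup0p : left_id part0 part_cup.
Proof. by move=> a; apply: part_perm; rewrite (permPl (perm_cup _ _)). Qed.

Fact part_cupp0 : right_id part0 part_cup.
Proof. by move=> a; rewrite part_cupC part_cup0p. Qed.

Fact part_cup_eq0 (la mu : intpart) :
  part_cup la mu = part0 -> la = part0 /\ mu = part0.
Proof.
move=> e; have := perm_size (perm_cup la mu); rewrite e size_cat /=.
case: la {e} => [[|x s] sP] //; case: mu => [[|y t] tP] // _.
by split; apply: val_inj.
Qed.

HB.instance Definition _ := Choice_isMonomialDef.Build intpart
  part_cupA part_cup0p part_cupp0 part_cup_eq0.
HB.instance Definition _ := MonomialDef_isConomialDef.Build intpart part_cupC.

(* The ring of symmetric functions with rational coefficients, presented by its
   linear basis of products of power sums: << la >> is Psi_la, and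
   << la >> * << mu >> is << part_cup la mu >>. *)
Notation symfun := {malg rat[intpart]}.

(* The largest part of la is at most sumn la, so that the product defining
   z_la ranges over all the parts. *)
Definition zpart (la : intpart) : nat :=
  (\prod_(1 <= i < (sumn la).+1) (i ^ count_mem i la * (count_mem i la)`!))%N.

(* The bilinear form with the values of jack_dot_psi on the basis Psi_la. *)
Definition jack_dot (alpha : rat) (f g : symfun) : rat :=
  \sum_(la <- msupp f) mcoeff la f * mcoeff la g * ((zpart la)%:R * alpha ^+ size la).

Lemma jack_dot_psi (alpha : rat) (la mu : intpart) :
  jack_dot alpha << la >> << mu >>
    = (la == mu)%:R * ((zpart la)%:R * alpha ^+ size la).
Proof.
rewrite /jack_dot msuppU1 big_seq_fset1 !mcoeffU1 eqxx mul1r.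
by rewrite eq_sym.
Qed.

Definition psi_prod (A : comAlgType rat) (psi : nat -> A) (la : intpart) : A :=
  \prod_(r <- la) psi r.

Fact psi_prod_mmorphism (A : comAlgType rat) (psi : nat -> A) :
  mmorphism (psi_prod psi).
Proof.
split; last by rewrite /psi_prod big_nil.
by move=> la mu; rewrite /psi_prod (perm_big _ (perm_cup la mu)) big_cat.
Qed.

HB.instance Definition _ (A : comAlgType rat) (psi : nat -> A) :=
  isMultiplicative.Build intpart A (psi_prod psi) (psi_prod_mmorphism psi).

(* The image of f under the algebra morphism Psi_r |-> psi r. *)
Definition psi_subst (A : comAlgType rat) (psi : nat -> A) (f : symfun) : A :=
  mmap (in_alg A) (psi_prod psi) f.

Definition powersum (A : comAlgType rat) (n : nat) (x : 'I_n -> A) (r : nat) : A :=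
  \sum_(i < n) x i ^+ r.

(* f(X) and f(-X) for the alphabet X of the x i. *)
Definition sf_eval (A : comAlgType rat) (n : nat) (x : 'I_n -> A) (f : symfun) : A :=
  psi_subst (powersum x) f.

Definition sf_eval_neg (A : comAlgType rat) (n : nat) (x : 'I_n -> A)
    (f : symfun) : A :=
  psi_subst (fun r => - powersum x r) f.

(* m_mu(X): the sum of the distinct monomials in the x i whose nonzero exponents
   are, up to order, the parts of mu; no exponent exceeds sumn mu. *)
Definition monomial_eval (A : comAlgType rat) (n : nat) (x : 'I_n -> A)
    (mu : intpart) : A :=
  \sum_(e : {ffun 'I_n -> 'I_(sumn mu).+1}
         | perm_eq [seq r <- [seq val (e i) | i <- enum 'I_n] | r != 0%N] mu)
    \prod_(i < n) x i ^+ e i.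

Definition dominated (mu la : intpart) : Prop :=
  sumn mu = sumn la /\
  (forall i : nat, (sumn (take i mu) <= sumn (take i la))%N).

Definition sdominated (mu la : intpart) : Prop := dominated mu la /\ mu <> la.

(* f = m_la + \sum_(mu < la) u_(la, mu) m_mu.  Only finitely many mu satisfy
   mu < la; the sum is over a list s of them.  Two symmetric functions are equal
   if and only if they agree in every finite number N of indeterminates, and the
   identity is expressed there; s and u do not depend on N. *)
Definition unitriangular (la : intpart) (f : symfun) : Prop :=
  exists (s : seq intpart) (u : intpart -> rat),
    (forall mu, mu \in s -> sdominated mu la) /\
    forall N : nat,
      let X := fun i : 'I_N => 'X_i : mpoly N rat in
      sf_eval X f =
        monomial_eval X la + \sum_(mu <- s) u mu *: monomial_eval X mu.

(* For alpha > 0 exactly one family P has this property: P la = P_la^(alpha). *)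
Definition is_jack (alpha : rat) (P : intpart -> symfun) : Prop :=
  (forall la mu, la <> mu -> jack_dot alpha (P la) (P mu) = 0) /\
  (forall la, unitriangular la (P la)).

Definition vandermonde (A : comAlgType rat) (n : nat) (x : 'I_n -> A) : A :=
  \prod_(i < n) \prod_(j < n | (i < j)%N) (x i - x j).

(* ((k + 1) n)! / ((k + 1)!)^n *)
Definition multinom_coef (n k : nat) : rat :=
  (k.+1 * n)`!%:R / (k.+1)`!%:R ^+ n.

(* Main.v *)
From HB Require Import structures.
Require Import Defs.
From mathcomp Require Import all_boot all_order all_algebra perm.
From mathcomp Require Import ring lra zify.
From mathcomp Require Import finmap monalg mpoly.

Set Implicit Arguments.
Unset Strict Implicit.
Unset Printing Implicit Defensive.

Import Order.TTheory GRing.Theory Num.Theory.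

Local Open Scope ring_scope.
Local Notation "x %:F" := (@tofrac _ x).

(** Let al = k + 1, L = (n - 1) k, and let la be the rectangle n^L. Write q_r for
    the signed elementary functions, sum_r q_r t^r = prod_z (1 - z t), with
    q_r = 0 for r < 0, and F for the product of the (y_j - y_i)^(k+1) over the
    ordered pairs i != j, in n variables y. Replacing in F every monomial y^b by
    the product of the q_(b_i - (n-1)) gives a symmetric function G, here
    [rect_sym]. The theorem compares two computations of G.

    Value on -X. There q_r becomes the complete function h_r(x), and
    y^b |-> h_(b-(n-1))(x) is the divided difference with nodes x, a combination
    of the evaluations at the x_l. Substituting letters for the n variables of F
    gives zero unless the letters are distinct, so G(-X) is n! times the product
    of the (x_j - x_i)^k over the ordered pairs, that is, up to sign, n! times
    the power 2 k of the Vandermonde product ([disc_subst_complete]).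

    Identification with the Jack polynomial: G = c P_la, with
    c = ((k+1) n)! / ((k+1)!)^n ([rect_sym_jack]).

    - The monomials of G have degree at most n in each letter, so their
      partitions are dominated by la, and the coefficient of the monomial of la
      in G is the constant term of Dyson, which is c ([dyson_constant_term]).

    - G is orthogonal to every w whose monomials are strictly below la. Indeed
      let X have n letters and evaluate G at -al X: now q_r becomes a complete
      function of the alphabet where each letter occurs k + 1 times. Expand in
      powers of one letter. A coefficient of degree less than L is obtained from
      a multiple of F by a functional with the n - 1 other letters as nodes, of
      multiplicity k + 1; two of the n variables share a node, and the factor
      (y_a - y_b)^(2k+2) of F kills the contribution ([moment_pigeonhole]). So
      G(-al X) is divisible by x_i^L for all i, and by homogeneity it is a
      multiple of (x_1 ... x_n)^L. Let now g_r be the functions such that the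
      scalar product with g_nu = g_(nu_1) g_(nu_2) ... extracts the coefficient
      of the monomial nu ([pairingP]). Their values at -al X are the signed
      elementary functions of X, so the kernel of the evaluation is the ideal of
      the g_r with r > n, and G is a multiple of g_n^L modulo this ideal. Both
      are orthogonal to w ([multi_eval_ker], [rect_sym_dot]).

    - Hence G - c P_la, whose monomials are strictly below la, is orthogonal to
      the Jack polynomials below la. These span the functions with monomials
      below la ([ortho_below]), so it is orthogonal to itself, and it is zero. *)

(** * Newton sequences *)
(** The list of the first values, latest first, so that each new value is
    defined from all the earlier ones by structural recursion. *)
Fixpoint newton_rev (A : comAlgType rat) (p : nat -> A) s : seq A :=
  if s is s'.+1 then
    (s%:R^-1 *: \sum_(i < s) p i.+1 * (newton_rev p s')`_i) :: newton_rev p s'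
  else [:: 1].

(** The coefficients of exp (sum_r p_r t^r / r). For power sums p_r of an
    alphabet these are its complete symmetric functions, and for their
    opposites the signed elementary ones; other multiples of power sums give
    other generators. *)
HB.lock Definition newton (A : comAlgType rat) (p : nat -> A) s : A :=
  (newton_rev p s)`_0.

Section NewtonSequence.
Variable A : comAlgType rat.
Implicit Types (p : nat -> A) (s : nat).

Lemma nth_newton_rev p s i : (i <= s)%N -> (newton_rev p s)`_i = newton p (s - i).
Proof.
rewrite newton.unlock; elim: s i => [|s IHs] [|i] //= le_is.
by rewrite IHs // subSS.
Qed.

Lemma newton0 p : newton p 0 = 1. Proof. by rewrite newton.unlock. Qed.

Lemma succ_natr_neq0 s : (s.+1%:R : rat) != 0.
Proof. by rewrite pnatr_eq0. Qed.

Lemma newtonS p s :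
  s.+1%:R * newton p s.+1 = \sum_(i < s.+1) p i.+1 * newton p (s - i).
Proof.
rewrite {1}newton.unlock /= mulr_natl -scaler_nat scalerA mulfV ?succ_natr_neq0 // scale1r.
by apply: eq_bigr => i _; rewrite nth_newton_rev // -ltnS.
Qed.

Lemma succ_natmul_inj s (a b : A) : s.+1%:R * a = s.+1%:R * b -> a = b.
Proof.
rewrite !mulr_natl -!scaler_nat => /(congr1 (fun x => s.+1%:R^-1 *: x)).
by rewrite !scalerA mulVf ?succ_natr_neq0 // !scale1r.
Qed.

(** The recursion of Newton, which says that the generating series F satisfies
    t F' = (sum_r p_r t^r) F, determines F from its value 1 at 0. *)
Lemma newton_uniq p (a : nat -> A) : a 0%N = 1 ->
  (forall s, s.+1%:R * a s.+1 = \sum_(i < s.+1) p i.+1 * a (s - i)%N) ->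
  a =1 newton p.
Proof.
move=> a0 aS s; have [m le_sm] := ubnP s; elim: m s le_sm => // m IHm [|s]; first by rewrite newton0.
rewrite ltnS => lt_sm; apply: (@succ_natmul_inj s); rewrite aS newtonS.
by apply: eq_bigr => i _; rewrite IHm // (leq_ltn_trans (leq_subr _ _)).
Qed.

Lemma eq_newton p p' : (forall r, p r.+1 = p' r.+1) -> newton p =1 newton p'.
Proof.
move=> eq_p; apply: newton_uniq => [|s]; rewrite ?newton0 // newtonS.
by apply: eq_bigr => i _; rewrite eq_p.
Qed.

Lemma newton_scale p (c : A) s : newton (fun r => c ^+ r * p r) s = c ^+ s * newton p s.
Proof.
symmetry; move: s; apply: newton_uniq => [|s]; first by rewrite newton0 mulr1.
rewrite mulrCA newtonS mulr_sumr; apply: eq_bigr => i _.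
by rewrite mulrACA -exprD addSn subnKC // -ltnS.
Qed.

Lemma newton_zero s : newton (fun=> 0 : A) s = (s == 0%N)%:R.
Proof.
symmetry; move: s; apply: newton_uniq => [|s] //=.
by rewrite mulr0 big1 // => i _; rewrite mul0r.
Qed.

Lemma coefM_trunc (f f' g g' : {poly A}) s :
    (forall i, (i <= s)%N -> f`_i = f'`_i) ->
    (forall i, (i <= s)%N -> g`_i = g'`_i) ->
  (f * g)`_s = (f' * g')`_s.
Proof.
move=> ff' gg'; rewrite !coefM; apply: eq_bigr => i _.
by rewrite ff' ?gg' ?leq_subr // -ltnS.
Qed.

(** The product of two exponential series satisfies the differential equation
    of the sum of the exponents. The series are truncated at a degree above [s]
    to compute with polynomials. *)
Lemma newtonD p p' s :
  newton (fun r => p r + p' r) s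
    = \sum_(i < s.+1) newton p i * newton p' (s - i).
Proof.
pose trunc n (a : nat -> A) := \poly_(i < n) a i.
have truncE n a i : (i < n)%N -> (trunc n a)`_i = a i.
  by move=> ltin; rewrite coef_poly ltin.
have E' n m (a b : nat -> A) : (n < m)%N ->
    \sum_(i < n.+1) a i * b (n - i)%N = (trunc m a * trunc m b)`_n.
  move=> ltnm; rewrite coefM; apply: eq_bigr => i _; rewrite !truncE //.
    exact: leq_ltn_trans (leq_subr _ _) _.
  by apply: leq_ltn_trans ltnm; rewrite -ltnS.
symmetry; move: s; apply: newton_uniq => [|s].
  by rewrite big_ord1 !newton0 mulr1.
pose M := s.+2; pose a := trunc M (newton p); pose b := trunc M (newton p').
pose u := trunc M (fun r => p r.+1); pose v := trunc M (fun r => p' r.+1).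
have dE q i : (i <= s)%N -> ((trunc M (newton q))^`())`_i
     = (trunc M (fun r => q r.+1) * trunc M (newton q))`_i.
  move=> leis; rewrite coef_deriv truncE; last by rewrite ltnS.
  by rewrite -mulr_natl newtonS -E' // ltnS (leq_trans leis).
rewrite (E' _ M) // mulr_natl -coef_deriv derivM coefD.
rewrite (@coefM_trunc _ (u * a) _ b) ; [|exact: dE|by []].
rewrite (@coefM_trunc a a _ (v * b)) ; [|by []|exact: dE].
rewrite -mulrA [a * (v * b)]mulrCA -coefD -mulrDl.
rewrite [in RHS](eq_bigr (fun i : 'I_s.+1 => (p i.+1 + p' i.+1) * (a * b)`_(s - i))); last first.
  move=> i _; rewrite -/a -/b; congr (_ * _).
  rewrite -E' // ltnS (leq_trans (leq_subr _ _)) //.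
rewrite coefM; apply: eq_bigr => i _; rewrite coefD !truncE //.
  by rewrite ltnS (leq_trans (ltnW (ltn_ord i))).
by rewrite ltnS (leq_trans (ltnW (ltn_ord i))).
Qed.

(** A single letter: exp (- sum_r c^r t^r / r) = 1 - c t. *)
Lemma newton_lin (c : A) s : newton (fun r => - c ^+ r) s = (1 - c *: 'X : {poly A})`_s.
Proof.
symmetry; move: s; apply: newton_uniq => [|s].
  by rewrite !coefE mulr0 subr0.
have cE t : (1 - c *: 'X : {poly A})`_t.+1 = - (t == 0%N)%:R * c.
  rewrite !coefE /= sub0r eqSS.
  by case: t => [|t] /=; rewrite ?mulr0 ?mulr1 ?mulN1r ?oppr0 ?mul0r.
have c0 : (1 - c *: 'X : {poly A})`_0 = 1 by rewrite !coefE mulr0 subr0.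
rewrite cE; case: s => [|s] /=.
  by rewrite big_ord1 subn0 c0 expr1 mulN1r mul1r mulr1.
rewrite !oppr0 mul0r mulr0 big_ord_recr /= subnn c0 big_ord_recr /= subSnn cE /=.
rewrite big1 => [|i _]; last first.
  have -> : (s.+1 - i = (s - i.+1).+2)%N by have := ltn_ord i; lia.
  by rewrite cE /= oppr0 mul0r mulr0.
by rewrite mulr1 add0r mulN1r mulrNN -exprSr subrr.
Qed.

Lemma newton_prod (I : Type) (r : seq I) (x : I -> A) s :
  newton (fun j => - \sum_(i <- r) x i ^+ j) s
    = (\prod_(i <- r) (1 - x i *: 'X) : {poly A})`_s.
Proof.
elim: r s => [|i r IHr] s.
  rewrite big_nil coef1 -newton_zero.
  by apply: eq_newton => j; rewrite big_nil oppr0.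
rewrite big_cons coefM.
rewrite (@eq_newton _ (fun j => - x i ^+ j + - \sum_(i0 <- r) x i0 ^+ j)).
  by rewrite newtonD; apply: eq_bigr => j _; rewrite IHr newton_lin.
by move=> j; rewrite big_cons opprD.
Qed.

(** The series of opposite power sums are inverse to each other, since their
    product is exp 0. *)
Lemma newton_rec p (f : {poly A}) : (forall s, newton (fun r => - p r) s = f`_s) ->
  forall s, \sum_(i < s.+1) f`_i * newton p (s - i) = (s == 0%N)%:R.
Proof.
move=> pf s; rewrite -newton_zero (@eq_newton _ (fun r => - p r + p r)).
  by rewrite newtonD; apply: eq_bigr => i _; rewrite pf.
by move=> r; rewrite addNr.
Qed.

End NewtonSequence.

Lemma newton_morph (A B : comAlgType rat) (f : {rmorphism A -> B}) (p : nat -> A) s :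
  f (newton p s) = newton (fun r => f (p r)) s.
Proof.
move: s; apply: newton_uniq => [|s]; first by rewrite newton0 rmorph1.
rewrite -(rmorph_nat f) -rmorphM newtonS rmorph_sum.
by apply: eq_bigr => i _; rewrite rmorphM.
Qed.

(** * Lagrange interpolation *)
Section Lagrange.
Variables (K : fieldType) (I : finType) (x : I -> K) (S : {set I}).
Hypothesis x_inj : {in S &, injective x}.

Definition lagrange_basis (i : I) : {poly K} :=
  \prod_(j in S :\ i) ((x i - x j)^-1 *: ('X - (x j)%:P)).

Lemma lagrange_basis_hit i : i \in S -> (lagrange_basis i).[x i] = 1.
Proof.
move=> Si; rewrite horner_prod big1 // => j /setD1P[ji Sj].
rewrite hornerZ hornerXsubC mulVf // subr_eq0.
by apply: contra ji => /eqP/x_inj->.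
Qed.

Lemma lagrange_basis_miss i j : j \in S -> j != i -> (lagrange_basis i).[x j] = 0.
Proof.
move=> Sj ji; rewrite horner_prod (bigD1 j) ?inE ?ji //=.
by rewrite hornerZ hornerXsubC subrr mulr0 mul0r.
Qed.

Lemma lagrange_basisE i : lagrange_basis i =
  (\prod_(j in S :\ i) (x i - x j)^-1) *: \prod_(j in S :\ i) ('X - (x j)%:P).
Proof. by rewrite /lagrange_basis scaler_prod. Qed.

Lemma size_lagrange_monic i : i \in S ->
  size (\prod_(j in S :\ i) ('X - (x j)%:P)) = #|S|.
Proof. by move=> Si; rewrite -big_enum size_prod_XsubC -cardE (cardsD1 i S) Si. Qed.

(** The difference of the two sides has the nodes as roots, more of them than
    its degree allows. *)
Lemma lagrange_interpolation (P : {poly K}) : (size P <= #|S|)%N ->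
  P = \sum_(i in S) P.[x i] *: lagrange_basis i.
Proof.
move=> szP; apply/eqP; rewrite -subr_eq0; apply/eqP.
apply: (@roots_geq_poly_eq0 _ _ [seq x i | i in S]).
- apply/allP => _ /mapP[j Sj ->]; rewrite mem_enum in Sj.
  rewrite /root !hornerE horner_sum (bigD1 j) //= hornerZ lagrange_basis_hit //.
  rewrite mulr1 big1 ?addr0 ?subrr // => i /andP[Si ij].
  by rewrite hornerZ lagrange_basis_miss ?mulr0 // eq_sym.
- by rewrite map_inj_in_uniq ?enum_uniq // => i j; rewrite !mem_enum; apply: x_inj.
rewrite size_map -cardE; apply: leq_trans (size_polyD _ _) _.
rewrite geq_max szP size_polyN /=; apply: leq_trans (size_sum _ _ _) _.
apply/bigmax_leqP => i Si; rewrite lagrange_basisE.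
by do 2!apply: leq_trans (size_scale_leq _ _) _; rewrite size_lagrange_monic.
Qed.

(** Interpolation of the constant 1, evaluated at 0. *)
Lemma lagrange_sum1 : S != set0 ->
  \sum_(i in S) \prod_(j in S :\ i) (x j / (x j - x i)) = 1.
Proof.
rewrite -card_gt0 => S_gt0.
have := @lagrange_interpolation 1; rewrite size_poly1 => /(_ S_gt0).
move=> /(congr1 (fun P : {poly K} => P.[0])); rewrite hornerC horner_sum => E; rewrite [RHS]E.
apply: eq_bigr => i Si; rewrite hornerC scale1r horner_prod.
apply: eq_bigr => j _; rewrite hornerZ hornerXsubC sub0r mulrN -mulNr -invrN opprB.
by rewrite mulrC.
Qed.

(** The leading coefficient of the interpolation of a power: divided
    differences of order n - 1 annihilate the powers of lower degree. *)
Lemma lagrange_moments (b : nat) : (b < #|S|)%N ->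
  \sum_(i in S) x i ^+ b * \prod_(j in S :\ i) (x i - x j)^-1 = (b == #|S|.-1)%:R.
Proof.
move=> lt_b; have := @lagrange_interpolation 'X^b; rewrite size_polyXn => /(_ lt_b).
move/(congr1 (fun P : {poly K} => P`_#|S|.-1)); rewrite coefXn coef_sum eq_sym => ->.
apply: eq_bigr => i Si; rewrite hornerXn coefZ lagrange_basisE coefZ.
rewrite -[X in _`_X.-1](size_lagrange_monic Si) -lead_coefE.
by rewrite (eqP (monic_prod_XsubC _ _ _)) mulr1.
Qed.

End Lagrange.

(** * Linear functionals on polynomials defined by a sequence of moments *)
(** The tensor power of the linear functional in one variable with moments [tau
    e]. *)
HB.lock Definition moment (K : fieldType) (n : nat) (tau : nat -> K) (p : mpoly n K) : K :=
  \sum_(m <- msupp p) p@_m * \prod_(i < n) tau (m i).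

Section Moments.
Variables (K : fieldType) (n : nat) (tau : nat -> K).
Local Notation moment := (@moment K n tau).

Lemma moment_sup (s : seq 'X_{1..n}) p : uniq s -> {subset msupp p <= s} ->
  moment p = \sum_(m <- s) p@_m * \prod_(i < n) tau (m i).
Proof.
move=> us ps; rewrite moment.unlock [RHS](bigID (fun m => m \in msupp p)) /= [X in _ + X]big1 ?addr0; last first.
  by move=> m mp; rewrite (memN_msupp_eq0 mp) mul0r.
rewrite -[RHS]big_filter; apply: perm_big; apply: uniq_perm => //.
  exact: filter_uniq.
by move=> m; rewrite mem_filter andb_idr //; apply: ps.
Qed.

Lemma moment_is_linear : linear (moment : _ -> K^o).
Proof.
move=> c p q; pose s := undup (msupp p ++ msupp q).
have us : uniq s by exact: undup_uniq.
have ps : {subset msupp p <= s} by move=> m mp; rewrite mem_undup mem_cat mp.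
have qs : {subset msupp q <= s} by move=> m mq; rewrite mem_undup mem_cat mq orbT.
have pqs : {subset msupp (c *: p + q) <= s}.
  move=> m /msuppD_le; rewrite mem_cat => /orP[/msuppZ_le/ps//|/qs//].
rewrite (moment_sup us pqs) (moment_sup us ps) (moment_sup us qs).
rewrite scaler_sumr -big_split /=; apply: eq_bigr => m _.
by rewrite mcoeffD mcoeffZ mulrDl [RHS]/(_ + _) -mulrA.
Qed.

HB.instance Definition _ :=
  GRing.isLinear.Build K (mpoly n K) K^o _ moment moment_is_linear.

Lemma momentZ c p : moment (c *: p) = c * moment p.
Proof. exact: (linearZ_LR (moment : {linear mpoly n K -> K^o})). Qed.

Lemma momentX m : moment 'X_[m] = \prod_(i < n) tau (m i).
Proof. by rewrite moment.unlock msuppX big_seq1 mcoeffX eqxx mul1r. Qed.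

(** Asking for the vanishing on all multiples makes these polynomials an ideal,
    so that vanishing can be proved on a factor. *)
Definition moment_null (p : mpoly n K) := forall g, moment (p * g) = 0.

Lemma moment_nullMr p g : moment_null p -> moment_null (p * g).
Proof. by move=> p0 h; rewrite -mulrA p0. Qed.

Lemma moment_null_sum (J : Type) (r : seq J) (Q : pred J) (F : J -> mpoly n K) :
  (forall j, Q j -> moment_null (F j)) -> moment_null (\sum_(j <- r | Q j) F j).
Proof.
by move=> F0 g; rewrite mulr_suml raddf_sum big1 // => j Qj; apply: F0.
Qed.

Definition at_var (a : 'I_n) (q : {poly K}) : mpoly n K :=
  (map_poly (mpolyC n (R := K)) q).['X_a].

Lemma at_varE a q : at_var a q = \sum_(l < size q) q`_l *: 'X_a ^+ l.
Proof.
rewrite /at_var (horner_coef_wide _ (size_poly _ _)); apply: eq_bigr => l _.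
by rewrite coef_map mul_mpolyC.
Qed.

Lemma at_varM a : {morph at_var a : p q / p * q}.
Proof. by move=> p q; rewrite /at_var rmorphM hornerM. Qed.

Lemma at_varXn a p m : at_var a (p ^+ m) = at_var a p ^+ m.
Proof. by rewrite /at_var rmorphXn horner_exp. Qed.

Lemma at_var_XsubC a c : at_var a ('X - c%:P) = 'X_a - c%:MP.
Proof. by rewrite /at_var rmorphB /= map_polyX map_polyC /= !hornerE. Qed.

(** Multiplication by the polynomial [q] in one variable turns one factor of
    the moment of a monomial into the left-hand side of the recurrence. *)
Lemma moment_null_rec a (q : {poly K}) :
  (forall e, \sum_(l < size q) q`_l * tau (e + l) = 0) -> moment_null (at_var a q).
Proof.
move=> q0 g; rewrite (mpolyE g) mulr_sumr raddf_sum big1 // => m _ /=.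
rewrite -scalerAr linearZ at_varE mulr_suml raddf_sum /=.
rewrite (eq_bigr (fun l : 'I_(size q) => (\prod_(i < n | i != a) tau (m i)) * (q`_l * tau (m a + l)))).
  by rewrite -mulr_sumr q0 mulr0 scaler0.
move=> l _; rewrite -scalerAl linearZ /= mpolyXn -mpolyXD momentX.
rewrite (bigD1 a) //= mnmDE mulmnE mnm1E eqxx mul1n addnC.
rewrite [RHS]mulrC [_ *: _]mulrA; congr (_ * _); apply: eq_bigr => i /negbTE ia.
by rewrite mnmDE mulmnE mnm1E eq_sym ia mul0n.
Qed.

End Moments.

(** * Nodes and products of differences *)

(** The product of Dyson without its denominators: \prod_(i != j) (1 - x_i /
    x_j)^(a_i), multiplied by the power of each x_j that clears the fractions.
    *)
Definition dyson_poly (R : comNzRingType) n (S : {set 'I_n}) (a : 'I_n -> nat) : mpoly n R :=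
  \prod_(i in S) \prod_(j in S :\ i) ('X_j - 'X_i) ^+ a i.

(** By induction: if a p + b P = 1, where P is the product of the other
    members, then the identity for these, inserted into a p 1 + b P, gives the
    one for the whole family. *)
Lemma bezout_coprime_family (K : fieldType) (I : eqType) (p : I -> {poly K}) (s : seq I) :
  uniq s -> (0 < size s)%N -> (forall i j, i != j -> coprimep (p i) (p j)) ->
  exists u : I -> {poly K}, 1 = \sum_(j <- s) u j * \prod_(i <- s | i != j) p i.
Proof.
move=> us s_gt0 cop; elim: s us s_gt0 => // i0 s IHs /andP[i0s us] _.
have [s0|] := posnP (size s).
  exists (fun=> 1); rewrite (size0nil s0) big_seq1 big_cons big_nil eqxx.
  by rewrite mul1r.
move=> /(IHs us)[u Eu]; have : coprimep (p i0) (\prod_(i <- s) p i).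
  elim: (s) i0s => [|i s' IHs']; first by rewrite big_nil coprimep1.
  rewrite inE negb_or => /andP[i0i /IHs' cs'].
  by rewrite big_cons coprimepMr cop.
case/Bezout_eq1_coprimepP=> -[a b] /= Eab.
exists (fun j => if j == i0 then b else a * u j).
rewrite big_cons eqxx big_cons eqxx /= [\prod_(_ <- s | _) _]big_seq_cond.
rewrite (eq_bigl (fun i => i \in s)) => [|i]; last first.
  by rewrite andb_idr // => si; apply: contraNneq i0s => <-.
rewrite -big_seq -[LHS]Eab addrC; congr (_ + _).
rewrite -[X in X * _]mulr1 [X in _ * X * _]Eu mulr_sumr mulr_suml.
apply: eq_big_seq => j sj; have ji0 : j != i0 by apply: contraNneq i0s => <-.
by rewrite (negbTE ji0) big_cons eq_sym ji0; ring.
Qed.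

Lemma at_var_sum (K : fieldType) n (a : 'I_n) (J : finType) (F : J -> {poly K}) :
  at_var a (\sum_j F j) = \sum_j at_var a (F j).
Proof. by rewrite /at_var rmorph_sum horner_sum. Qed.

Lemma at_var1 (K : fieldType) n (a : 'I_n) : at_var a (1 : {poly K}) = 1.
Proof. by rewrite /at_var rmorph1 hornerC. Qed.

Lemma dyson_poly_collision (R : comNzRingType) n r (a b : 'I_n) : a != b ->
  exists Q : mpoly n R, dyson_poly R setT (fun=> r)
    = ('X_a - 'X_b) ^+ r * ('X_b - 'X_a) ^+ r * Q.
Proof.
move=> ab; pose F (i : 'I_n) : mpoly n R := \prod_(j in setT :\ i) ('X_j - 'X_i) ^+ r.
pose G (i j : 'I_n) : mpoly n R := \prod_(l in setT :\ i | l != j) ('X_l - 'X_i) ^+ r.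
have FG i j : i != j -> F i = ('X_j - 'X_i) ^+ r * G i j.
  by move=> ij; rewrite /F (bigD1 j) // !inE eq_sym ij.
exists (G a b * (G b a * \prod_(i in setT | (i != a) && (i != b)) F i)).
rewrite /dyson_poly (bigD1 a) ?inE //= -/(F a) (bigD1 b) /= ?inE 1?eq_sym //.
rewrite -/(F b) (FG _ _ ab) (FG b a) 1?eq_sym //.
set P := \prod_(_ | _) _; rewrite [X in G b a * X](_ : _ = P); first by ring.
by apply: eq_bigl => i; rewrite inE.
Qed.

Section Pigeonhole.
Variables (K : fieldType) (N n r : nat) (t : 'I_N -> K) (tau : nat -> K).
Hypothesis t_inj : injective t.
Let factor j : {poly K} := ('X - (t j)%:P) ^+ r.
Let q := \prod_(j < N) factor j.
Hypothesis tau_rec : forall e, \sum_(l < size q) q`_l * tau (e + l) = 0.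
Local Notation null := (@moment_null K n tau).

Lemma moment_null_mul p p' : null p -> null (p' * p).
Proof. by move=> p0; rewrite mulrC; apply: moment_nullMr. Qed.

(** Expand the power of X_a - X_b = (X_a - t_j) - (X_b - t_j), whose exponent
    is 2 r: every term contains one of the two differences to a power at least
    r, and completes the factor [c] to a multiple of the polynomial of the
    recurrence in that variable. *)
Lemma moment_null_collision (a b : 'I_n) j (c : {poly K}) :
    c * factor j = q ->
  null (at_var a c * at_var b c * (('X_a - 'X_b) ^+ r * ('X_b - 'X_a) ^+ r)).
Proof.
move=> cq; rewrite -exprMn; set ya := 'X_a - (t j)%:MP.
pose yb : mpoly n K := 'X_b - (t j)%:MP.
have -> : ('X_a - 'X_b) * ('X_b - 'X_a) = - (ya - yb) ^+ 2.
  by rewrite /ya /yb; ring.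
rewrite -mulN1r exprMn -exprM exprBn !mulr_sumr.
apply: moment_null_sum => i _.
have null_at d : null (at_var d c * ('X_d - (t j)%:MP) ^+ r).
  rewrite -at_var_XsubC -at_varXn -at_varM cq.
  exact: moment_null_rec.
rewrite -mulr_natr; have [le_ri|lt_ir] := leqP r i.
  have /moment_null_mul := null_at b; rewrite -/yb => nb.
  rewrite -[X in yb ^+ X](subnK le_ri) exprD.
  set s := (-1) ^+ r; set s' := (-1) ^+ i; set x := ya ^+ _; set y := yb ^+ (i - r).
  set z := yb ^+ r; set m := _%:R.
  have -> : at_var a c * at_var b c * (s * (s' * x * (y * z) * m)) =
    (at_var a c * (s * (s' * x * y * m))) * (at_var b c * z) by ring.
  exact: nb.
have /moment_null_mul := null_at a; rewrite -/ya => na.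
have -> : (2 * r - i = (r - i) + r)%N by lia.
rewrite exprD; set s := (-1) ^+ r; set s' := (-1) ^+ i; set x := ya ^+ (r - i).
set y := yb ^+ i; set z := ya ^+ r; set m := _%:R.
have -> : at_var a c * at_var b c * (s * (s' * (x * z) * y * m)) =
  (at_var b c * (s * (s' * x * y * m))) * (at_var a c * z) by ring.
exact: na.
Qed.

(** A partition of unity on the nodes, in each variable, splits the functional
    into parts indexed by the assignments of nodes to the variables. With fewer
    nodes than variables two variables share a node, and the part vanishes. *)
Lemma moment_pigeonhole : (0 < N)%N -> (N < n)%N ->
  null (dyson_poly K setT (fun=> r)).
Proof.
move=> N_gt0 ltNn; pose c j := \prod_(i < N | i != j) factor i.
have cq j : c j * factor j = q by rewrite /q (bigD1 j) //= mulrC.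
have [u Eu] : exists u, 1 = \sum_(j < N) u j * c j.
  have [||i j ij|u Eu] := @bezout_coprime_family K _ factor (index_enum 'I_N).
  - exact: index_enum_uniq.
  - by rewrite -[index_enum _]enumT -cardE card_ord.
  - apply: coprimep_expl; apply: coprimep_expr; apply: coprimep_XsubC2.
    by rewrite subr_eq0; apply: contra ij => /eqP/t_inj->.
  by exists u.
have -> : dyson_poly K setT (fun=> r) = \sum_(f : {ffun 'I_n -> 'I_N})
    dyson_poly K setT (fun=> r) * \prod_a at_var a (u (f a) * c (f a)).
  rewrite -mulr_sumr -(bigA_distr_bigA (fun a j => at_var a (u j * c j))).
  by rewrite big1 ?mulr1 // => a _; rewrite -at_var_sum -Eu at_var1.
apply: moment_null_sum => f _.
have /injectivePn[a [b ab fab]] : ~~ injectiveb f.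
  apply/injectiveP => /leq_card; rewrite !card_ord; lia.
have [Q ->] := dyson_poly_collision K r ab.
rewrite (bigD1 a) //= (bigD1 b) 1?eq_sym //= !at_varM -fab.
have /moment_null_mul col := @moment_null_collision a b (f a) (c (f a)) (cq _).
set x := _ ^+ r; set y := _ ^+ r; set z := \prod_(_ | _) _.
set ua := at_var a (u _); set ub := at_var b (u _).
set ca := at_var a (c _); set cb := at_var b (c _).
have -> : x * y * Q * (ua * ca * (ub * cb * z)) = (Q * ua * ub * z) * (ca * cb * (x * y)).
  by ring.
exact: col.
Qed.

End Pigeonhole.

(** The functional is a combination of evaluations at assignments of nodes to
    the variables; the product of the differences vanishes at all of them
    except the permutations, where it takes a single value. *)
Lemma moment_simple_nodes (K : fieldType) n r (x w : 'I_n -> K) (tau : nat -> K) :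
  (forall e, tau e = \sum_l w l * x l ^+ e) -> (0 < r)%N ->
  @moment K n tau (dyson_poly K setT (fun=> r)) =
    n`!%:R * (\prod_l w l) * \prod_i \prod_(j in setT :\ i) (x j - x i) ^+ r.
Proof.
move=> tauE r_gt0.
have momentE (p : mpoly n K) : @moment K n tau p = \sum_(f : {ffun 'I_n -> 'I_n})
    (\prod_i w (f i)) * p.@[fun i => x (f i)].
  rewrite {1}(mpolyE p) raddf_sum /= (eq_bigr (fun m => \sum_(f : {ffun 'I_n -> 'I_n})
      p@_m * \prod_(i < n) (w (f i) * x (f i) ^+ m i))) => [|m _].
    rewrite exchange_big; apply: eq_bigr => f _.
    rewrite [in RHS]mevalE mulr_sumr; apply: eq_bigr => m _.
    by rewrite big_split /= mulrCA.
  rewrite momentZ momentX -mulr_sumr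
    -(bigA_distr_bigA (fun i j => w j * x j ^+ m i)); congr (_ * _).
  by apply: eq_bigr => i _; rewrite tauE.
have evalE (y : 'I_n -> K) : (dyson_poly K setT (fun=> r)).@[y] =
    \prod_i \prod_(j in setT :\ i) (y j - y i) ^+ r.
  rewrite rmorph_prod big_mkcond; apply: eq_bigr => i _.
  rewrite inE rmorph_prod; apply: eq_bigr => j _.
  by rewrite rmorphXn rmorphB /= !mevalXU.
rewrite momentE (bigID (fun f : {ffun 'I_n -> 'I_n} => injectiveb f)) /= addrC big1 ?add0r.
  set W := \prod_l w l; set D := \prod_i _.
  transitivity (\sum_(f : {ffun 'I_n -> 'I_n} | injectiveb f) W * D).
    apply: eq_bigr => f /injectiveP f_inj; pose s := perm f_inj.
    have sE i : f i = s i by rewrite permE.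
    congr (_ * _).
      rewrite /W [RHS](reindex_inj (@perm_inj _ s)) /=.
      by apply: eq_bigr => i _; rewrite sE.
    rewrite evalE /D [RHS](reindex_inj (@perm_inj _ s)) /=; apply: eq_bigr => i _.
    rewrite [RHS](reindex_inj (@perm_inj _ s)) /=; apply: eq_big => [j|j _].
      by rewrite !inE (inj_eq perm_inj).
    by rewrite !sE.
  rewrite sumr_const -mulrA mulr_natl; congr (_ *+ _).
  have := card_inj_ffuns 'I_n 'I_n; rewrite !card_ord ffactnn => <-.
  by apply: eq_card => f; rewrite inE.
move=> f /injectivePn[a [b ab fab]]; rewrite evalE [X in _ * X](bigD1 a) //=.
rewrite [X in _ * (X * _)](bigD1 b) /=.
  by rewrite fab subrr expr0n gtn_eqF // !mul0r mulr0.
by rewrite !inE eq_sym ab.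
Qed.

Lemma tofrac_inj (R : idomainType) : injective (@tofrac R).
Proof. by move=> p q /eqP; rewrite tofrac_eq => /eqP. Qed.

(** * Newton sequences as moments *)
Lemma frac_var_inj n : injective (fun i : 'I_n => ('X_i : mpoly n rat)%:F).
Proof.
move=> i j /tofrac_inj/(congr1 (fun p : mpoly n rat => p@_U_(i)%MM)).
by rewrite !mcoeffXU eqxx; case: eqP => [->|_ /eqP]; rewrite ?oner_eq0.
Qed.

Lemma size_prod_1subX (A : comNzRingType) (s : seq A) :
  (size (\prod_(t <- s) (1 - t *: 'X) : {poly A})%R <= (size s).+1)%N.
Proof.
elim: s => [|t s IHs]; first by rewrite big_nil size_poly1.
rewrite big_cons; apply: leq_trans (size_polyMleq _ _) _ => /=.
have sz2 : (size (1 - t *: 'X : {poly A})%R <= 2)%N.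
  rewrite (leq_trans (size_polyD _ _)) // geq_max size_poly1 size_polyN.
  by rewrite (leq_trans (size_scale_leq _ _)) // size_polyX.
by rewrite -subn1 leq_subLR (leq_trans (leq_add sz2 IHs)).
Qed.

(** The two products are reciprocal polynomials. *)
Lemma prod_XsubC_rev (A : comNzRingType) (ts : seq A) l : (l <= size ts)%N ->
  (\prod_(t <- ts) ('X - t%:P))`_l = (\prod_(t <- ts) (1 - t *: 'X) : {poly A})`_(size ts - l).
Proof.
elim: ts l => [|t ts IHts] l; first by rewrite leqn0 => /eqP->; rewrite !big_nil.
rewrite !big_cons !mulrBl !coefB mul1r -scalerAl !coefXM coefCM coefZ coefXM /=.
case: l => [_|l le_l].
  rewrite !subn0 /= sub0r [X in _ = X - _]nth_default ?sub0r //.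
    by rewrite IHts // subn0.
  exact: size_prod_1subX.
rewrite subSS /=; move: le_l; rewrite /= ltnS leq_eqVlt => /orP[/eqP->|lt_l].
  rewrite subnn /= mulr0 [X in _ - _ * X = _]nth_default ?size_prod_XsubC //.
  rewrite mulr0.
  by rewrite IHts // subnn.
rewrite -[(size ts - l)%N](subnSK lt_l) /= IHts; last exact: ltnW.
by rewrite subnSK // IHts // -(subnSK lt_l).
Qed.

Definition shift (A : nmodType) (s : nat -> A) (c e : nat) : A :=
  if (c <= e)%N then s (e - c)%N else 0.

(** The recurrence of the complete functions fails only at index 0. Delayed by
    one less than the number of letters, that is preceded by so many zeros,
    they satisfy it from the first index on. *)
Lemma newton_annihil (A : comAlgType rat) (ts : seq A) e : (0 < size ts)%N ->
  \sum_(l < (size ts).+1) (\prod_(t <- ts) ('X - t%:P))`_l *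
    shift (newton (fun r => \sum_(t <- ts) t ^+ r)) (size ts).-1 (e + l) = 0.
Proof.
move=> ts_gt0; set d := size ts; set h := newton _.
pose f : {poly A} := \prod_(t <- ts) (1 - t *: 'X).
have := @newton_rec A (fun r => \sum_(t <- ts) t ^+ r) f _ e.+1.
rewrite -/h => rec.
have szf i : (d < i)%N -> f`_i = 0.
  by move=> lt_i; rewrite nth_default // (leq_trans (size_prod_1subX ts)).
rewrite (reindex_inj rev_ord_inj) /=.
pose F i := if (i <= e.+1)%N then f`_i * h (e.+1 - i)%N else 0.
transitivity (\sum_(i < d.+1) F i).
  apply: eq_bigr => i _; have le_i : (i <= d)%N by rewrite -ltnS.
  rewrite subSS prod_XsubC_rev ?leq_subr // subKn // -/f /F /shift.
  have -> : (d.-1 <= e + (d - i))%N = (i <= e.+1)%N by rewrite /d in le_i *; lia.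
  case: ifP => _; last by rewrite mulr0.
  by congr (_ * h _); rewrite /d in le_i *; lia.
have widen m : (d.+1 <= m)%N -> \sum_(i < d.+1) F i = \sum_(i < m) F i.
  move=> le_m; rewrite (big_ord_widen m F le_m) big_mkcond; apply: eq_bigr => i _.
  by case: ltnP => // lt_i; rewrite /F szf ?mul0r ?if_same.
have widen' m : (e.+2 <= m)%N -> \sum_(i < e.+2) F i = \sum_(i < m) F i.
  move=> le_m; rewrite (big_ord_widen m F le_m) big_mkcond; apply: eq_bigr => i _.
  by case: ltnP => // lt_i; rewrite /F leqNgt lt_i.
rewrite (widen (maxn d.+1 e.+2)) ?leq_maxl // -widen' ?leq_maxr //.
rewrite -[RHS]rec; last by move=> s; rewrite -newton_prod.
by apply: eq_bigr => i _; rewrite /F -ltnS ltn_ord.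
Qed.

(** * The discriminant as a functional on sequences *)
Section RecUniq.
Variables (K : fieldType) (q : {poly K}) (u v : nat -> K).
Hypothesis q_monic : q \is monic.
Hypothesis u_rec : forall e, \sum_(l < size q) q`_l * u (e + l) = 0.
Hypothesis v_rec : forall e, \sum_(l < size q) q`_l * v (e + l) = 0.

Lemma rec_uniq : (forall e, (e < (size q).-1)%N -> u e = v e) -> u =1 v.
Proof.
move=> uv e; have [m] := ubnP e; elim: m e => // m IHm e lt_e.
have [/uv//|le_e] := ltnP e (size q).-1.
have q_gt0 : (0 < size q)%N by rewrite size_poly_gt0 monic_neq0.
have := etrans (u_rec (e - (size q).-1)) (esym (v_rec (e - (size q).-1))).
move: q_gt0 le_e lt_e (monicP q_monic); rewrite lead_coefE.
case: (size q) => // d _ /= le_e lt_e qd; rewrite !big_ord_recr /= qd !mul1r subnK //.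
rewrite (eq_bigr (fun l : 'I_d => q`_l * v (e - d + l)%N)); first by move/addrI.
by move=> l _; rewrite IHm //; have := ltn_ord l; lia.
Qed.
End RecUniq.

Section Frac.
Variables (N n : nat).
Local Notation R := (mpoly N rat).
Local Notation K := {fraction R}.

Definition rat_frac (c : rat) : K := (c%:MP : R)%:F.

HB.instance Definition _ := GRing.RMorphism.copy rat_frac (@tofrac R \o mpolyC N (R := rat)).

Lemma map_dyson_poly S (a : 'I_n -> nat) :
  map_mpoly rat_frac (dyson_poly rat S a) = dyson_poly K S a.
Proof.
rewrite rmorph_prod; apply: eq_bigr => i _; rewrite rmorph_prod; apply: eq_bigr => j _.
by rewrite rmorphXn rmorphB /= !map_mpolyX.
Qed.

Lemma moment_map tau (p : mpoly n rat) (d : 'X_{1..n}) :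
  @moment K n tau (map_mpoly rat_frac p * 'X_[d]) =
    \sum_(m <- msupp p) rat_frac p@_m * \prod_(i < n) tau (m i + d i)%N.
Proof.
rewrite {1}(mpolyE p) raddf_sum mulr_suml raddf_sum; apply: eq_bigr => m _ /=.
rewrite map_mpolyZ map_mpolyX -scalerAl momentZ -mpolyXD momentX.
by congr (_ * _); apply: eq_bigr => i _; rewrite mnmDE.
Qed.

Lemma frac_moments_rec (ts : seq R) (tau : nat -> K) (q : {poly K}) : (0 < size ts)%N ->
    (forall e, tau e = (shift (newton (fun r => \sum_(t <- ts) t ^+ r)) (size ts).-1 e)%:F) ->
    q = \prod_(t <- ts) ('X - (t%:F)%:P) ->
  forall e, \sum_(l < size q) q`_l * tau (e + l)%N = 0.
Proof.
move=> ts_gt0 tauE qE e.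
have {}qE : q = map_poly (@tofrac R) (\prod_(t <- ts) ('X - t%:P)).
  rewrite qE rmorph_prod; apply: eq_bigr => t _.
  by rewrite rmorphB /= map_polyX map_polyC.
have -> : size q = (size ts).+1.
  by rewrite qE size_map_inj_poly ?rmorph0 ?size_prod_XsubC //; apply: tofrac_inj.
have := congr1 (@tofrac R) (newton_annihil e ts_gt0); rewrite rmorph_sum rmorph0 => E.
rewrite -[RHS]E; apply: eq_bigr => l _.
by rewrite rmorphM qE coef_map tauE.
Qed.

End Frac.

Section DiscSubst.
Variables (n k : nat).

Definition disc_power : mpoly n rat := dyson_poly rat setT (fun=> k.+1).

(** The umbral substitution of [c i e] for the power [e] of the variable of
    index [i]. *)
Definition disc_subst (A : comAlgType rat) (c : 'I_n -> nat -> A) : A :=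
  \sum_(m <- msupp disc_power) disc_power@_m *: \prod_(i < n) c i (m i).

Lemma disc_subst_morph (A B : comAlgType rat) (f : {lrmorphism A -> B}) c :
  f (disc_subst c) = disc_subst (fun i e => f (c i e)).
Proof.
rewrite raddf_sum; apply: eq_bigr => m _.
by rewrite /= linearZ /= rmorph_prod.
Qed.

Lemma frac_disc_subst N (c : 'I_n -> nat -> mpoly N rat) :
  (disc_subst c)%:F = \sum_(m <- msupp disc_power) rat_frac N disc_power@_m * \prod_(i < n) (c i (m i))%:F.
Proof.
rewrite raddf_sum; apply: eq_bigr => m _ /=.
by rewrite -mul_mpolyC rmorphM rmorph_prod.
Qed.

End DiscSubst.

Lemma swap_pairs (R : comPzRingType) n (F : 'I_n -> 'I_n -> R) :
  \prod_i \prod_(j in setT :\ i) F i j = \prod_i \prod_(j in setT :\ i) F j i.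
Proof.
rewrite (exchange_big_dep xpredT) //=; apply: eq_bigr => i _; apply: eq_bigl => j.
by rewrite !inE eq_sym.
Qed.

Lemma horner_node (K : fieldType) n (x : 'I_n -> K) i :
  (\prod_(j < n) ('X - (x j)%:P)).[x i] = 0.
Proof. by rewrite horner_prod (bigD1 i) //= hornerXsubC subrr mul0r. Qed.

(** By partial fractions, the delayed complete functions are the moments of a
    divided difference, a combination of the evaluations at the letters; these
    are simple nodes, as many as there are variables. *)
Lemma disc_subst_complete n k : (0 < n)%N ->
  disc_subst k (fun _ : 'I_n => shift (newton (fun r => \sum_(i < n) ('X_i : mpoly n rat) ^+ r)) n.-1)
    = n`!%:R * \prod_i \prod_(j in setT :\ i) ('X_j - 'X_i) ^+ k.
Proof.
move=> n_gt0; apply: (@tofrac_inj (mpoly n rat)).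
pose ts : seq (mpoly n rat) := [seq 'X_i | i : 'I_n <- index_enum 'I_n].
pose c := shift (newton (fun r => \sum_(i < n) ('X_i : mpoly n rat) ^+ r)) n.-1.
pose tau e : {fraction mpoly n rat} := (c e)%:F.
pose x (i : 'I_n) : {fraction mpoly n rat} := ('X_i)%:F.
have x_inj : injective x := @frac_var_inj n.
have size_ts : size ts = n by rewrite size_map -[index_enum _]enumT -cardE card_ord.
pose q : {poly {fraction mpoly n rat}} := \prod_(i < n) ('X - (x i)%:P).
pose w l := \prod_(j in setT :\ l) (x l - x j)^-1.
have size_q : size q = n.+1.
  by rewrite /q size_prod_XsubC -[index_enum _]enumT -cardE card_ord.
have tauE : tau =1 (fun e => \sum_l w l * x l ^+ e).
  apply: (@rec_uniq _ q).
  - exact: monic_prod_XsubC.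
  - apply: (@frac_moments_rec n ts); rewrite ?size_ts //.
      move=> e; rewrite /tau /c; congr (_ %:F); rewrite /shift; case: ifP => // _.
      by apply: eq_newton => r; rewrite big_map.
    by rewrite big_map.
  - move=> e; under eq_bigr => l _ do rewrite mulr_sumr.
    rewrite exchange_big big1 // => i _.
    transitivity (w i * x i ^+ e * q.[x i]).
      rewrite horner_coef mulr_sumr; apply: eq_bigr => l _.
      by rewrite exprD [RHS]mulrCA !mulrA.
    by rewrite horner_node mulr0.
  move=> e; rewrite size_q /= => lt_e; have := @lagrange_moments _ _ x setT (in2W x_inj) e.
  rewrite cardsT card_ord => /(_ lt_e) E.
  have -> : \sum_l w l * x l ^+ e = (e == n.-1)%:R.
    by rewrite -[RHS]E; apply: eq_big => [i|i _]; [rewrite inE|rewrite [LHS]mulrC].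
  rewrite /tau /c /shift; have [->|ne] := eqVneq e n.-1.
    by rewrite leqnn subnn newton0 rmorph1.
  by rewrite ifF ?rmorph0 //; move/eqP: ne; lia.
rewrite frac_disc_subst.
have := moment_map tau (disc_power n k) 0%MM; rewrite mpolyX0 mulr1 /disc_power map_dyson_poly => E.
transitivity (moment tau (dyson_poly {fraction mpoly n rat} setT (fun=> k.+1) : mpoly n _)).
  rewrite E; apply: eq_bigr => m _; congr (_ * _); apply: eq_bigr => i _.
  by rewrite mnm0E addn0.
rewrite (moment_simple_nodes tauE) // rmorphM rmorph_nat -mulrA; congr (_ * _).
rewrite rmorph_prod /w swap_pairs -big_split; apply: eq_bigr => i _ /=.
rewrite rmorph_prod -big_split; apply: eq_bigr => j /setD1P[ji _] /=.
rewrite rmorphXn rmorphB -/(x i) -/(x j) exprS mulKf //.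
by rewrite subr_eq0; apply: contra ji => /eqP/x_inj->.
Qed.

(** * The vanishing order of the value on a multiple of the alphabet *)
Lemma mcoeff_Xn_lt (R : comNzRingType) n (j : 'I_n) r (p : mpoly n R) (m : 'X_{1..n}) :
  (m j < r)%N -> ('X_j ^+ r * p)@_m = 0.
Proof.
move=> lt_r; apply: memN_msupp_eq0; rewrite mpolyXn mulrC (perm_mem (msuppMX _ _)).
apply/mapP => -[m' _ E]; move: lt_r; rewrite E mnmDE mulmnE mnm1E eqxx mul1n.
by rewrite ltnNge leq_addr.
Qed.

(** The alphabet in which each letter occurs [r] times. *)
Definition repeat_seq (T : Type) r (s : seq T) : seq T := flatten (nseq r s).

Lemma big_repeat_sum (V : nmodType) (T : Type) r (s : seq T) (F : T -> V) :
  \sum_(t <- repeat_seq r s) F t = (\sum_(t <- s) F t) *+ r.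
Proof.
elim: r => [|r IHr]; first by rewrite big_nil.
by rewrite /repeat_seq /= big_cat IHr mulrS.
Qed.

Lemma big_repeat_prod (A : comPzRingType) (T : Type) r (s : seq T) (F : T -> A) :
  \prod_(t <- repeat_seq r s) F t = (\prod_(t <- s) F t) ^+ r.
Proof.
elim: r => [|r IHr]; first by rewrite big_nil.
by rewrite /repeat_seq /= big_cat IHr exprS.
Qed.

Lemma size_repeat_seq (T : Type) r (s : seq T) : size (repeat_seq r s) = (r * size s)%N.
Proof. by elim: r => // r IHr; rewrite /repeat_seq /= size_cat IHr mulSn. Qed.

Section Multiple.
Variables (N k : nat) (j0 : 'I_N.+1).
Hypothesis N_gt0 : (0 < N)%N.
Local Notation n := N.+1.
Local Notation R := (mpoly n rat).

(** The complete functions of the alphabet in which each letter occurs [k.+1]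
    times. *)
Definition multi_complete : nat -> R := newton (fun r => (\sum_(i < n) 'X_i ^+ r) *+ k.+1).

Let H' : nat -> R := newton (fun r => (\sum_(j < N) 'X_(lift j0 j) ^+ r) *+ k.+1).
Let W : nat -> R := newton (fun=> k.+1%:R).

(** The letter of index [j0] is separated from the others, whose complete
    functions are [H']; the coefficients [W] are those of (1 - t)^(-(k+1)). *)
Lemma multi_completeE c :
  multi_complete c = \sum_(d < c.+1) ('X_j0 ^+ d * W d) * H' (c - d).
Proof.
rewrite /multi_complete (@eq_newton _ _ (fun r => 'X_j0 ^+ r * k.+1%:R +
    (\sum_(j < N) 'X_(lift j0 j) ^+ r) *+ k.+1)).
  by rewrite newtonD; apply: eq_bigr => d _; rewrite newton_scale.
move=> r; rewrite mulr_natr -mulrnDl; congr (_ *+ _).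
rewrite (bigD1 j0) //=; congr (_ + _).
rewrite (reindex (lift j0)) /=.
  by apply: eq_bigl => j; rewrite eq_sym neq_lift.
exists (fun i => odflt (Ordinal N_gt0) (unlift j0 i)) => i.
  by rewrite liftK.
by rewrite inE eq_sym => /unlift_some[j -> ->].
Qed.

Lemma shift_multi_complete B e : (e < B)%N ->
  shift multi_complete N e = \sum_(d < B) ('X_j0 ^+ d * W d) * shift H' (N + d) e.
Proof.
move=> lt_e; rewrite {1}/shift; case: leqP => [le_N|lt_N]; last first.
  by rewrite big1 // => d _; rewrite /shift leqNgt ltn_addr ?mulr0.
rewrite multi_completeE (big_ord_widen B (fun d => 'X_j0 ^+ d * W d * H' (e - N - d))); last first.
  by lia.
rewrite big_mkcond; apply: eq_bigr => d _; rewrite /shift.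
have -> : (d < (e - N).+1)%N = (N + d <= e)%N by lia.
by rewrite subnDA; case: ifP; rewrite ?mulr0.
Qed.

(** Up to a monomial factor, whose exponents are nonnegative as soon as the [f
    i] are small, this is the functional whose nodes are the [N] other letters,
    each of multiplicity [k.+1]: fewer nodes than variables. *)
Lemma disc_subst_shift_eq0 B (f : 'I_n -> 'I_B) : (\sum_i f i < N * k)%N ->
  disc_subst k (fun i : 'I_n => shift H' (N + f i)) = 0.
Proof.
move=> lt_f; apply: (@tofrac_inj R); rewrite rmorph0 frac_disc_subst.
pose ts : seq R := repeat_seq k.+1 [seq 'X_(lift j0 j) | j : 'I_N <- index_enum 'I_N].
have size_ts : size ts = (k.+1 * N)%N.
  by rewrite size_repeat_seq size_map -[index_enum _]enumT -cardE card_ord.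
pose tau e : {fraction R} := (shift H' (size ts).-1 e)%:F.
pose t j : {fraction R} := ('X_(lift j0 j))%:F.
pose d : 'X_{1..n} := [multinom ((N * k).-1 - f i)%N | i < n].
have t_inj : injective t := inj_comp (@frac_var_inj n) (@lift_inj _ j0).
have tau_rec := @frac_moments_rec n ts tau (\prod_(t <- ts) ('X - (t%:F)%:P)).
rewrite size_ts muln_gt0 N_gt0 in tau_rec.
have {tau_rec} : forall e, \sum_(l < size (\prod_(j < N) ('X - (t j)%:P) ^+ k.+1))
    (\prod_(j < N) ('X - (t j)%:P) ^+ k.+1)`_l * tau (e + l)%N = 0.
  rewrite (_ : \prod_(j < N) ('X - (t j)%:P) ^+ k.+1 = \prod_(t <- ts) ('X - (t%:F)%:P)).
    apply: tau_rec => // e; rewrite /tau size_ts; congr (_ %:F).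
    rewrite /shift; case: ifP => // _; apply: eq_newton => r.
    by rewrite big_repeat_sum big_map.
  by rewrite big_repeat_prod big_map prodrXl.
move=> tau_rec; have := moment_pigeonhole t_inj tau_rec N_gt0 (leqnn n) 'X_[d].
rewrite -map_dyson_poly moment_map => E; rewrite -[RHS]E.
apply: eq_bigr => m _; rewrite (eq_bigr (fun i => tau (m i + d i)%N)) // => i _.
have le_fi : (f i <= \sum_i f i)%N by rewrite (bigD1 i) //= leq_addr.
rewrite /tau mnmE /shift size_ts; congr (_ %:F).
have -> : ((k.+1 * N).-1 <= m i + ((N * k).-1 - f i))%N = (N + f i <= m i)%N by nia.
by case: ifP => // le_m; congr H'; nia.
Qed.

(** In the expansion in powers of one letter, the coefficients of low degree
    are values of functionals with the other letters as nodes, which are too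
    few. *)
Lemma disc_subst_multi_complete (m : 'X_{1..n}) : (m j0 < N * k)%N ->
  (disc_subst k (fun _ : 'I_n => shift multi_complete N))@_m = 0.
Proof.
move=> lt_m; pose B := msize (disc_power n k).
have -> : disc_subst k (fun _ : 'I_n => shift multi_complete N) =
    \sum_(f : {ffun 'I_n -> 'I_B}) 'X_j0 ^+ (\sum_i f i) *
      ((\prod_i W (f i)) * disc_subst k (fun i : 'I_n => shift H' (N + f i))).
  transitivity (\sum_(f : {ffun 'I_n -> 'I_B}) \sum_(m <- msupp (disc_power n k)) 'X_j0 ^+ (\sum_i f i) *
      ((\prod_i W (f i)) * ((disc_power n k)@_m *: \prod_i shift H' (N + f i) (m i)))).
    rewrite exchange_big; apply: eq_big_seq => u u_supp.
    rewrite (eq_bigr (fun i => \sum_(d < B) ('X_j0 ^+ d * W d) * shift H' (N + d) (u i))).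
      rewrite bigA_distr_bigA scaler_sumr; apply: eq_bigr => f _.
      by rewrite !big_split /= -mulrA !scalerAr prodrXr.
    move=> i _; apply: shift_multi_complete; apply: leq_ltn_trans (msize_mdeg_lt u_supp).
    by rewrite mdegE (bigD1 i) //= leq_addr.
  by apply: eq_bigr => f _; rewrite -!mulr_sumr.
rewrite raddf_sum big1 // => f _ /=.
have [/disc_subst_shift_eq0->|le_f] := ltnP (\sum_i f i) (N * k).
  by rewrite !mulr0 mcoeff0.
by rewrite mcoeff_Xn_lt // (leq_trans lt_m).
Qed.

End Multiple.

(** * The constant term identity of Dyson *)
Section DegreeBound.
Variables (n : nat) (i : 'I_n).
Implicit Types p q : mpoly n rat.

(** A strict bound on the degree in the variable of index [i], without a
    convention for the zero polynomial. *)
Definition deg_lt c p := forall m : 'X_{1..n}, (c <= m i)%N -> p@_m = 0.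

Lemma deg_ltP c p m : deg_lt c p -> m \in msupp p -> (m i < c)%N.
Proof. by move=> pc; rewrite mcoeff_msupp ltnNge; apply: contraNN => /pc->. Qed.

Lemma deg_ltM c d p q : deg_lt c p -> deg_lt d.+1 q -> deg_lt (c + d) (p * q).
Proof.
move=> pc qd m le_m; apply: memN_msupp_eq0; apply/negP => /msuppM_le.
case/allpairsP => -[m1 m2] /= [/(deg_ltP pc) lt1 /(deg_ltP qd) lt2 E].
by move: le_m; rewrite E mnmDE; lia.
Qed.

Lemma deg_ltD c p q : deg_lt c p -> deg_lt c q -> deg_lt c (p + q).
Proof. by move=> pc qc m le_m; rewrite mcoeffD pc ?qc ?addr0. Qed.

Lemma deg_lt_Xn c : deg_lt c.+1 ('X_i ^+ c).
Proof.
move=> m le_m; rewrite mcoeffXn; case: eqP => // E; move: le_m.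
by rewrite -E mulmnE mnm1E eqxx mul1n ltnn.
Qed.

(** Monic of degree [c] in the variable of index [i], with no other letters in
    the leading coefficient. *)
Definition lead_power c p := deg_lt c (p - 'X_i ^+ c).

Lemma lead_power_lt c p : lead_power c p -> deg_lt c.+1 p.
Proof.
move=> pc; rewrite -[p](subrK ('X_i ^+ c)); apply: deg_ltD; last exact: deg_lt_Xn.
by move=> m le_m; apply: pc; apply: ltnW.
Qed.

Lemma lead_powerM c d p q :
  lead_power c p -> lead_power d q -> lead_power (c + d) (p * q).
Proof.
move=> pc qd; rewrite /lead_power.
have -> : p * q - 'X_i ^+ (c + d) =
    (p - 'X_i ^+ c) * q + (q - 'X_i ^+ d) * 'X_i ^+ c by rewrite exprD; ring.
apply: deg_ltD; first exact: deg_ltM pc (lead_power_lt qd).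
by rewrite addnC; have := deg_ltM qd (@deg_lt_Xn c).
Qed.

Lemma lead_power0 : lead_power 0 1.
Proof. by move=> m _; rewrite expr0 subrr mcoeff0. Qed.

Lemma lead_power_sub j : j != i -> lead_power 1 ('X_i - 'X_j).
Proof.
move=> ji m le_m; rewrite expr1 addrC addKr mcoeffN mcoeffX.
case: eqP => [E|]; last by rewrite oppr0.
by move: le_m; rewrite -E mnm1E (negbTE ji).
Qed.

Lemma lead_powerX c p e : lead_power c p -> lead_power (c * e) (p ^+ e).
Proof.
move=> pc; elim: e => [|e IHe]; first by rewrite muln0; apply: lead_power0.
by rewrite exprS mulnS; apply: lead_powerM.
Qed.

Lemma lead_power_coef c p q (m : 'X_{1..n}) : lead_power c p -> deg_lt 1 q ->
  (q * p)@_(m + U_(i) *+ c)%MM = if m i == 0%N then q@_m else 0.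
Proof.
move=> pc q1; rewrite -[p](subrK ('X_i ^+ c)) mulrDr mcoeffD.
rewrite mpolyXn [in X in _ + X]addmC mcoeffMX [X in X + _](_ : _ = 0) ?add0r.
  by case: eqP => // /eqP; rewrite -lt0n; apply: q1.
rewrite mulrC; have := @deg_ltM c 0 _ _ pc q1; rewrite addn0 -mpolyXn; apply.
by rewrite mnmDE mulmnE mnm1E eqxx mul1n leq_addl.
Qed.

End DegreeBound.

Section Dyson.
Variable n : nat.
Implicit Types (S : {set 'I_n}) (a : 'I_n -> nat).

(** The exponents that correspond to the constant term once the denominators
    are cleared. *)
Definition dyson_exp S a : 'X_{1..n} :=
  [multinom if i \in S then ((\sum_(j in S) a j) - a i)%N else 0%N | i < n].

Lemma dyson_poly_remove S a i : i \in S -> a i = 0%N ->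
  dyson_poly rat S a =
    dyson_poly rat (S :\ i) a * \prod_(j in S :\ i) ('X_i - 'X_j) ^+ a j.
Proof.
move=> Si ai; rewrite /dyson_poly (big_setD1 i Si) /= big1 => [|j _]; last first.
  by rewrite ai expr0.
rewrite mul1r -big_split; apply: eq_bigr => j /setD1P[ji Sj] /=.
rewrite (big_setD1 i) ?inE ?[i == j]eq_sym ?ji //= mulrC; congr (_ * _).
by apply: eq_bigl => l; rewrite !inE; do !case: (_ == _).
Qed.

Lemma deg_lt_dyson_poly S a i : i \notin S -> deg_lt i 1 (dyson_poly rat S a).
Proof.
move=> nSi; have one : deg_lt i 1 1.
  by move=> m le_m; rewrite mcoeff1; case: eqP le_m => [->|//]; rewrite mnm0E.
have mul p q : deg_lt i 1 p -> deg_lt i 1 q -> deg_lt i 1 (p * q).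
  by move=> p1 q1; have := deg_ltM p1 q1.
have var j : j != i -> deg_lt i 1 'X_j.
  move=> ji m le_m; rewrite mcoeffX; case: eqP => // E.
  by move: le_m; rewrite -E mnm1E (negbTE ji).
rewrite /dyson_poly; apply: (big_ind (deg_lt i 1)) => // j Sj.
apply: (big_ind (deg_lt i 1)) => // l /setD1P[_ Sl].
have d1 : deg_lt i 1 ('X_l - 'X_j).
  apply: deg_ltD; first by apply: var; apply: contraNneq nSi => <-.
  move=> m le_m; rewrite mcoeffN var ?oppr0 //.
  by apply: contraNneq nSi => <-.
by elim: (a j) => [|e IHe]; rewrite ?expr0 // exprS; apply: mul.
Qed.

Definition decr (a : 'I_n -> nat) i j := (a j - (j == i))%N.

Lemma dyson_poly_decr S a i : i \in S -> (0 < a i)%N ->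
  dyson_poly rat S a = \prod_(j in S :\ i) ('X_j - 'X_i) * dyson_poly rat S (decr a i).
Proof.
move=> Si ai; rewrite /dyson_poly !(big_setD1 i Si) /= mulrA; congr (_ * _).
  rewrite -big_split; apply: eq_bigr => j _ /=.
  by rewrite -exprS /decr eqxx subn1 prednK.
apply: eq_bigr => j /setD1P[ji _]; apply: eq_bigr => l _.
by rewrite /decr (negbTE ji) subn0.
Qed.

(** Good's recurrence: the constant 1 is split by Lagrange interpolation, and
    the denominators of each part cancel factors of the product. *)
Lemma dyson_poly_good S a : S != set0 -> (forall i, i \in S -> (0 < a i)%N) ->
  dyson_poly rat S a =
    \sum_(i in S) (\prod_(j in S :\ i) 'X_j) * dyson_poly rat S (decr a i).
Proof.
move=> S0 a_gt0; apply: (@tofrac_inj (mpoly n rat)).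
pose x (i : 'I_n) : {fraction mpoly n rat} := ('X_i)%:F.
have x_inj : injective x := @frac_var_inj n.
rewrite -[LHS]mulr1 -(lagrange_sum1 (in2W x_inj) S0) mulr_sumr rmorph_sum.
apply: eq_bigr => i Si; rewrite (dyson_poly_decr Si (a_gt0 i Si)) !rmorphM mulrAC.
rewrite !rmorph_prod -big_split.
rewrite (eq_bigr x) // => j /setD1P[ji _]; rewrite [LHS]/= rmorphB.
rewrite -/(x i) -/(x j) mulrC divfK //.
by rewrite subr_eq0; apply: contra ji => /eqP/x_inj->.
Qed.

Lemma mcoeff_varset_mul (T : {set 'I_n}) (p : mpoly n rat) (m : 'X_{1..n}) :
  ((\prod_(j in T) 'X_j) * p)@_([multinom nat_of_bool (j \in T) | j < n] + m)%MM = p@_m.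
Proof.
have -> : \prod_(j in T) 'X_j = 'X_[[multinom nat_of_bool (j \in T) | j < n]] :> mpoly n rat.
  rewrite mpolyXE_id big_mkcond; apply: eq_bigr => j _; rewrite mnmE.
  by case: (j \in T).
by rewrite mulrC mcoeffMX.
Qed.

(** Good's proof of Dyson's conjecture: the multinomial coefficients satisfy
    the same recurrence. It is available when all the exponents are positive; a
    variable with exponent 0 contributes only through its highest power, and
    can be removed from the set of active variables. *)
Lemma dyson_constant_term S a :
  (dyson_poly rat S a)@_(dyson_exp S a) =
    (\sum_(i in S) a i)`!%:R / \prod_(i in S) (a i)`!%:R.
Proof.
have [b] := ubnP (#|S| + \sum_(i in S) a i); elim: b S a => // b IHb S a lt_b.
have [->|S0] := eqVneq S set0.
  rewrite /dyson_poly !big_set0 mcoeff1 invr1 mulr1 fact0.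
  by rewrite (_ : dyson_exp _ _ = 0%MM) ?eqxx //; apply/mnmP => i; rewrite mnmE inE mnm0E.
have [/exists_inP[i Si /eqP ai]|/exists_inPn a_neq0] := boolP [exists i in S, a i == 0%N].
  have sumE : (\sum_(j in S) a j = \sum_(j in S :\ i) a j)%N.
    by rewrite (big_setD1 i Si) /= ai.
  rewrite (dyson_poly_remove Si ai).
  have lead : lead_power i (\sum_(j in S :\ i) a j) (\prod_(j in S :\ i) ('X_i - 'X_j) ^+ a j).
    elim/big_ind2: _ => [|c p d q|j /setD1P[ji _]]; first exact: lead_power0.
      exact: lead_powerM.
    by rewrite -{1}[a j]mul1n; apply/lead_powerX/lead_power_sub.
  have -> : dyson_exp S a = (dyson_exp (S :\ i) a + U_(i) *+ (\sum_(j in S :\ i) a j))%MM.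
    apply/mnmP => j; rewrite mnmDE mulmnE !mnmE sumE in_setD1 eq_sym.
    by case: eqP => [<-|_]; rewrite ?Si ?ai ?subn0 ?add0n ?mul1n //= mul0n addn0.
  rewrite (lead_power_coef _ lead); last by apply: deg_lt_dyson_poly; rewrite !inE eqxx.
  rewrite mnmE !inE eqxx /= IHb; last by move: lt_b; rewrite sumE (cardsD1 i S) Si; lia.
  by rewrite sumE [in RHS](big_setD1 i Si) /= ai fact0 mul1r.
have a_gt0 i : i \in S -> (0 < a i)%N by move=> /a_neq0; rewrite lt0n.
set A := (\sum_(i in S) a i)%N in lt_b *.
have A_ge i : i \in S -> (a i <= A)%N by move=> Si; rewrite /A (big_setD1 i Si) leq_addr.
have A_ge2 i j : i \in S -> j \in S -> j != i -> (a i + a j <= A)%N.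
  move=> Si Sj ji; rewrite /A (big_setD1 i Si) leq_add2l (big_setD1 j) ?leq_addr //.
  by rewrite !inE ji.
have sum_decr i : i \in S -> (\sum_(j in S) decr a i j = A.-1)%N.
  move=> Si; rewrite /A !(big_setD1 i Si) /= /decr eqxx.
  rewrite (eq_bigr a) => [|j /setD1P[/negbTE-> _]]; last by rewrite subn0.
  by move: (a_gt0 i Si); lia.
rewrite (dyson_poly_good S0 a_gt0) raddf_sum /=.
have A_gt0 : (0 < A)%N.
  by case/set0Pn: S0 => i Si; apply: leq_trans (a_gt0 i Si) (A_ge i Si).
rewrite (eq_bigr (fun i => (a i)%:R * (A.-1)`!%:R / \prod_(j in S) (a j)`!%:R)) => [|i Si].
  rewrite -!mulr_suml -natr_sum -/A; congr (_ / _).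
  by rewrite -{3}(prednK A_gt0) factS natrM prednK.
have -> : dyson_exp S a =
    ([multinom nat_of_bool (j \in S :\ i) | j < n] + dyson_exp S (decr a i))%MM.
  apply/mnmP => j; rewrite mnmDE !mnmE in_setD1 sum_decr // -/A /decr.
  case: (boolP (j \in S)) => Sj; last by rewrite andbF.
  have [->|ji] := eqVneq j i; first by have := a_gt0 i Si; have := A_ge i Si; lia.
  by have := A_ge2 i j Si Sj ji; have := a_gt0 i Si; rewrite /= subn0; lia.
rewrite mcoeff_varset_mul IHb; last by rewrite sum_decr // ; move: lt_b; lia.
rewrite sum_decr // -mulrA mulrCA; congr (_ * _).
rewrite !(big_setD1 i Si) /= {1}/decr eqxx subn1.
rewrite (eq_bigr (fun j => (a j)`!%:R)) => [|j /setD1P[/negbTE ji _]]; last first.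
  by rewrite /decr ji subn0.
rewrite -{2 3}(prednK (a_gt0 i Si)) factS natrM -mulrA [in RHS]invfM mulrA.
by rewrite mulfV ?mul1r // pnatr_eq0.
Qed.

End Dyson.

(** * Homogeneity *)
Section Homogeneous.
Variable n : nat.
Implicit Types p q : mpoly n rat.

Definition homogen d p := forall m : 'X_{1..n}, p@_m != 0 -> mdeg m = d.

Lemma homogen0 d : homogen d 0.
Proof. by move=> m; rewrite mcoeff0 eqxx. Qed.

Lemma homogen1 : homogen 0 1.
Proof.
by move=> m; rewrite mcoeff1; have [->|_] := eqVneq m 0%MM; rewrite ?mdeg0 ?eqxx.
Qed.

Lemma homogenX i : homogen 1 'X_i.
Proof.
by move=> m; rewrite mcoeffX; have [<-|_] := eqVneq U_(i)%MM m; rewrite ?mdeg1 ?eqxx.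
Qed.

Lemma homogenD d p q : homogen d p -> homogen d q -> homogen d (p + q).
Proof.
move=> hp hq m; rewrite mcoeffD; have [p0|/hp //] := eqVneq p@_m 0.
by rewrite p0 add0r; apply: hq.
Qed.

Lemma homogenZ d c p : homogen d p -> homogen d (c *: p).
Proof. by move=> hp m; rewrite mcoeffZ mulf_eq0 negb_or => /andP[_ /hp]. Qed.

Lemma homogen_sum d (I : Type) (r : seq I) (Q : pred I) (F : I -> mpoly n rat) :
  (forall i, Q i -> homogen d (F i)) -> homogen d (\sum_(i <- r | Q i) F i).
Proof.
by move=> hF; apply: (big_ind (homogen d)) => //; [apply: homogen0 | apply: homogenD].
Qed.

Lemma homogenM d e p q : homogen d p -> homogen e q -> homogen (d + e) (p * q).
Proof.
move=> hp hq m; rewrite -mcoeff_msupp => /msuppM_le/allpairsP[[m1 m2]] /=.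
by rewrite !mcoeff_msupp => -[/hp <- /hq <- ->]; rewrite mdegD.
Qed.

Lemma homogen_exp d p e : homogen d p -> homogen (d * e) (p ^+ e).
Proof.
move=> hp; elim: e => [|e IHe]; first by rewrite muln0; apply: homogen1.
by rewrite exprS mulnS; apply: homogenM.
Qed.

Lemma homogen_prod (I : Type) (r : seq I) (Q : pred I) (d : I -> nat) (F : I -> mpoly n rat) :
  (forall i, Q i -> homogen (d i) (F i)) ->
  homogen (\sum_(i <- r | Q i) d i) (\prod_(i <- r | Q i) F i).
Proof.
move=> hF; apply: (big_ind2 homogen) => //; first exact: homogen1.
by move=> ? ? ? ?; apply: homogenM.
Qed.

Lemma homogen_newton (p : nat -> mpoly n rat) s :
  (forall r, homogen r.+1 (p r.+1)) -> homogen s (newton p s).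
Proof.
move=> hp; have [m] := ubnP s; elim: m s => // m IHm [|s] lt_s.
  by rewrite newton0; apply: homogen1.
have -> : newton p s.+1 = s.+1%:R^-1 *: (\sum_(i < s.+1) p i.+1 * newton p (s - i)).
  by rewrite -newtonS mulr_natl -scaler_nat scalerA mulVf ?scale1r // pnatr_eq0.
apply: homogenZ; apply: homogen_sum => i _.
have h : homogen (i.+1 + (s - i)) (p i.+1 * newton p (s - i)).
  by apply: homogenM => //; apply: IHm; apply: leq_ltn_trans (leq_subr _ _) _.
have E : (i.+1 + (s - i) = s.+1)%N by rewrite addSn subnKC // -ltnS.
by rewrite E in h.
Qed.

Lemma homogen_disc_power k : homogen (n * (n.-1 * k.+1)) (disc_power n k).
Proof.
have -> : (n * (n.-1 * k.+1) = \sum_(i in [set: 'I_n]) \sum_(j in setT :\ i) k.+1)%N.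
  rewrite (eq_bigr (fun=> n.-1 * k.+1)%N) => [|i _].
    by rewrite sum_nat_const cardsT card_ord.
  rewrite sum_nat_const; congr (_ * _)%N.
  by have := cardsD1 i setT; rewrite cardsT card_ord inE add1n => /(congr1 predn).
apply: homogen_prod => i _; apply: homogen_prod => j _.
rewrite -[k.+1 in X in homogen X _]mul1n; apply: homogen_exp; apply: homogenD; first exact: homogenX.
by rewrite -scaleN1r; apply/homogenZ/homogenX.
Qed.

End Homogeneous.

(** All the exponents are at least N k, and the total degree leaves no room for
    a larger one. *)
Lemma disc_subst_multi_supp N k (m : 'X_{1..N.+1}) :
  (disc_subst k (fun _ : 'I_N.+1 => shift (multi_complete N k) N))@_m != 0 ->
  m = [multinom (N * k)%N | _ < N.+1].
Proof.
move=> ne0; have le_m j : (N * k <= m j)%N.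
  case: (posnP N) => [N0|N_gt0]; first by have -> : (N * k = 0)%N by rewrite N0.
  rewrite leqNgt; apply: contra ne0 => lt_m.
  by rewrite (disc_subst_multi_complete N_gt0 lt_m).
have deg_m : mdeg m = (N.+1 * (N * k))%N.
  move: m ne0 {le_m}; apply: homogen_sum => u _.
  have [u0|/homogen_disc_power deg_u] := eqVneq (disc_power N.+1 k)@_u 0.
    by rewrite u0 scale0r; apply: homogen0.
  apply: homogenZ; have [/forallP le_u|/forallPn[i lt_u]] := boolP [forall i, N <= u i]%N; last first.
    by rewrite (bigD1 i) //= /shift (negbTE lt_u) mul0r; apply: homogen0.
  have -> : (N.+1 * (N * k) = \sum_(i < N.+1) (u i - N))%N.
    rewrite sumnB // -mdegE deg_u sum_nat_const card_ord /=; nia.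
  apply: homogen_prod => i _; rewrite /shift le_u; apply: homogen_newton => r.
  rewrite -scaler_nat; apply: homogenZ; apply: homogen_sum => j _.
  by rewrite -{1}[r.+1]mul1n; apply/homogen_exp/homogenX.
apply/mnmP => j; rewrite mnmE; apply/eqP; rewrite eqn_leq le_m andbT.
have := leqif_sum (fun (i : 'I_N.+1) (_ : true) => leqif_eq (le_m i)).
rewrite -mdegE deg_m sum_nat_const card_ord => /leqifP.
case: ifP => [/forallP h _|_]; last by rewrite ltnn.
by have := h j; rewrite eq_sym => /eqP->.
Qed.

Lemma dyson_coef N k :
  (disc_power N.+1 k)@_[multinom (N + N * k)%N | _ < N.+1] = (N.+1 * k.+1)`!%:R / (k.+1)`!%:R ^+ N.+1.
Proof.
have := dyson_constant_term setT (fun _ : 'I_N.+1 => k.+1).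
rewrite sum_nat_const prodr_const cardsT card_ord -/(disc_power _ _) => <-.
congr mcoeff; apply/mnmP => i; rewrite !mnmE inE sum_nat_const cardsT card_ord; lia.
Qed.

(** * Linear extension from the power sum basis *)
Section LinearExtension.
Variables (V : lmodType rat) (v : intpart -> V).

Definition lin_ext (f : symfun) : V :=
  \sum_(la <- monalg.msupp f) monalg.mcoeff la f *: v la.

Lemma lin_ext_sup (d : {fset intpart}) (f : symfun) :
  (monalg.msupp f `<=` d)%fset ->
  lin_ext f = \sum_(la <- d) monalg.mcoeff la f *: v la.
Proof.
move=> le; rewrite [LHS](big_fset_incl _ le) => //= x xd /mcoeff_outdom ->.
by rewrite scale0r.
Qed.

Fact lin_ext_is_linear : linear lin_ext.
Proof.
move=> c f g; pose d := (monalg.msupp f `|` monalg.msupp g)%fset.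
have le1 : (monalg.msupp (c *: f + g) `<=` d)%fset.
  apply: fsubset_trans (monalg.msuppD_le _ _) _.
  exact: fsetSU (monalg.msuppZ_le _ _).
rewrite (lin_ext_sup le1) (lin_ext_sup (fsubsetUl _ _ : _ `<=` d)%fset).
rewrite (lin_ext_sup (fsubsetUr _ _ : _ `<=` d)%fset) scaler_sumr -big_split /=.
by apply: eq_bigr => la _; rewrite monalg.mcoeffD monalg.mcoeffZ scalerDl scalerA.
Qed.

HB.instance Definition _ :=
  GRing.isLinear.Build rat symfun V _ lin_ext lin_ext_is_linear.

Lemma lin_extU la : lin_ext << la >> = v la.
Proof. by rewrite /lin_ext msuppU1 big_seq_fset1 mcoeffU1 eqxx scale1r. Qed.

End LinearExtension.

Lemma symfun_basisE (f : symfun) :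
  f = \sum_(la <- monalg.msupp f) monalg.mcoeff la f *: << la >>.
Proof.
rewrite [LHS]monalgE; apply: eq_bigr => la _.
by apply/malgP => k; rewrite monalg.mcoeffZ mcoeffU mcoeffU1 mulr_natr.
Qed.

Lemma symfun_lin_ind (K : symfun -> Prop) :
  (forall la, K << la >>) -> K 0 -> (forall c f g, K f -> K g -> K (c *: f + g)) ->
  forall f, K f.
Proof.
move=> KU K0 KZD f; rewrite [f]symfun_basisE.
elim: (enum_fset _) => [|la s IHs]; first by rewrite big_nil.
by rewrite big_cons; apply: KZD.
Qed.

Lemma symfun_ext (V : lmodType rat) (u v : {linear symfun -> V}) :
  (forall la, u << la >> = v << la >>) -> u =1 v.
Proof.
move=> uv f; rewrite [f]symfun_basisE !linear_sum; apply: eq_bigr => la _.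
by rewrite !linearZ /= uv.
Qed.

Lemma symfunU_mul (la mu : intpart) :
  << la >> * << mu >> = << part_cup la mu >> :> symfun.
Proof. by rewrite malgM_def fgmulUU mulr1. Qed.

(** * Power sums *)
Fact is_part1 (r : nat) : is_part [:: r.+1]. Proof. by []. Qed.

Definition part1 (r : nat) : intpart := IntPart (is_part1 r).

(** The power sum of index 0 would be the number of letters, which is no
    symmetric function; 0 is a default value. *)
Definition psum (r : nat) : symfun := if r is r'.+1 then << part1 r' >> else 0.

Fact is_part_behead (la : intpart) : is_part (behead la).
Proof.
case: la => [[|r s] //= /andP[/path_sorted ss]].
by rewrite /is_part inE negb_or ss => /andP[].
Qed.

Lemma symfunU_ind (K : intpart -> Prop) :
  K part0 -> (forall r la, K la -> K (part_cup (part1 r) la)) ->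
  forall la, K la.
Proof.
move=> K0 K1 la; have [m] := ubnP (size la).
elim: m la => // m IHm [[|[|r] s] sP] lt_m.
- by have ->: IntPart sP = part0 by apply: val_inj.
- by exfalso; move: (sP); rewrite /is_part inE eqxx andbF.
have -> : IntPart sP = part_cup (part1 r) (IntPart (is_part_behead (IntPart sP))).
  apply: part_perm; rewrite perm_sym (permPl (perm_cup _ _)).
  exact: perm_refl.
by apply: K1; apply: IHm.
Qed.

Lemma psi_substE (A : comAlgType rat) (psi : nat -> A) :
  psi_subst psi =1 lin_ext (psi_prod psi).
Proof.
by move=> f; apply: eq_bigr => la _; rewrite -mulr_algl.
Qed.

Section PsiSubst.
Variables (A : comAlgType rat) (psi : nat -> A).

Fact psi_subst_is_linear : linear (psi_subst psi).
Proof. by move=> c f g; rewrite !psi_substE linearP. Qed.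

Fact psi_subst_is_multiplicative : multiplicative (psi_subst psi).
Proof. exact: monalg.mmap_is_multiplicative. Qed.

HB.instance Definition _ :=
  GRing.isLinear.Build rat symfun A _ (psi_subst psi) psi_subst_is_linear.
HB.instance Definition _ :=
  GRing.isMultiplicative.Build symfun A (psi_subst psi) psi_subst_is_multiplicative.

Lemma psi_subst_psum r : psi_subst psi (psum r.+1) = psi r.+1.
Proof. by rewrite psi_substE lin_extU /psi_prod big_seq1. Qed.

End PsiSubst.

(** * The scalar product *)
Section Dot.
Variable al : rat.

Definition psi_norm (la : intpart) : rat := (zpart la)%:R * al ^+ size la.

Lemma jack_dotE f g :
  jack_dot al f g
    = lin_ext (fun la => (monalg.mcoeff la g * psi_norm la : rat^o)) f.
Proof. by apply: eq_bigr => la _; rewrite -mulrA. Qed.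

Lemma jack_dotUr f la : jack_dot al f << la >> = monalg.mcoeff la f * psi_norm la.
Proof.
pose c mu : rat^o := (mu == la)%:R * psi_norm la.
transitivity (lin_ext c f).
  rewrite jack_dotE; apply: eq_bigr => mu _.
  by rewrite mcoeffU1 /c eq_sym; case: eqP => [->|] //; rewrite !mul0r.
rewrite [in RHS](symfun_basisE f) raddf_sum mulr_suml.
by apply: eq_bigr => mu _; rewrite /= monalg.mcoeffZ mcoeffU1 /c -mulrA.
Qed.

Fact jack_dot_linear_l g : linear (fun f => jack_dot al f g : rat^o).
Proof. by move=> c f f'; rewrite !jack_dotE linearP. Qed.

Fact jack_dot_linear_r f : linear (fun g => jack_dot al f g : rat^o).
Proof.
move=> c g g'; rewrite /jack_dot scaler_sumr -big_split /=.
apply: eq_bigr => la _; rewrite monalg.mcoeffD monalg.mcoeffZ.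
by rewrite /GRing.scale /=; ring.
Qed.

(** The scalar product in each argument, as functions to which a linear
    structure can be attached. *)
Definition dotl g f : rat^o := jack_dot al f g.
Definition dotr f g : rat^o := jack_dot al f g.

HB.instance Definition _ g :=
  GRing.isLinear.Build rat symfun rat^o _ (dotl g) (@jack_dot_linear_l g).
HB.instance Definition _ f :=
  GRing.isLinear.Build rat symfun rat^o _ (dotr f) (@jack_dot_linear_r f).

Lemma jack_dotC f g : jack_dot al f g = jack_dot al g f.
Proof.
suff E : dotl g =1 dotr g by exact: E.
apply: symfun_ext => la; change (jack_dot al << la >> g = jack_dot al g << la >>).
by rewrite jack_dotUr jack_dotE lin_extU.
Qed.

Lemma jack_dotDl f g h : jack_dot al (f + g) h = jack_dot al f h + jack_dot al g h.
Proof. exact: (raddfD (dotl h)). Qed.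
Lemma jack_dotDr f g h : jack_dot al h (f + g) = jack_dot al h f + jack_dot al h g.
Proof. exact: (raddfD (dotr h)). Qed.
Lemma jack_dotBl f g h : jack_dot al (f - g) h = jack_dot al f h - jack_dot al g h.
Proof. exact: (raddfB (dotl h)). Qed.
Lemma jack_dotBr f g h : jack_dot al h (f - g) = jack_dot al h f - jack_dot al h g.
Proof. exact: (raddfB (dotr h)). Qed.
Lemma jack_dotZl c f h : jack_dot al (c *: f) h = c * jack_dot al f h.
Proof. exact: (linearZ_LR (dotl h)). Qed.
Lemma jack_dotZr c f h : jack_dot al h (c *: f) = c * jack_dot al h f.
Proof. exact: (linearZ_LR (dotr h)). Qed.
Lemma jack_dot_suml (I : Type) (r : seq I) (Q : pred I) (F : I -> symfun) h :
  jack_dot al (\sum_(i <- r | Q i) F i) h = \sum_(i <- r | Q i) jack_dot al (F i) h.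
Proof. exact: (raddf_sum (dotl h)). Qed.
Lemma jack_dot_sumr (I : Type) (r : seq I) (Q : pred I) (F : I -> symfun) h :
  jack_dot al h (\sum_(i <- r | Q i) F i) = \sum_(i <- r | Q i) jack_dot al h (F i).
Proof. exact: (raddf_sum (dotr h)). Qed.
Lemma jack_dot0l h : jack_dot al 0 h = 0.
Proof. exact: (raddf0 (dotl h)). Qed.
Lemma jack_dot0r h : jack_dot al h 0 = 0.
Proof. exact: (raddf0 (dotr h)). Qed.

Lemma zpart_gt0 la : (0 < zpart la)%N.
Proof.
rewrite /zpart; elim/big_ind: _ => // [x y|i _]; first by rewrite muln_gt0 => -> ->.
rewrite muln_gt0 fact_gt0 andbT expn_gt0.
case: i => // ; case/andP: (partsP la) => _ /count_memPn -> //.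
Qed.

Lemma psi_norm_gt0 la : 0 < al -> 0 < psi_norm la.
Proof. by move=> al_gt0; rewrite mulr_gt0 ?exprn_gt0 // ltr0n zpart_gt0. Qed.

Lemma jack_dot_definite f : 0 < al -> jack_dot al f f = 0 -> f = 0.
Proof.
move=> al_gt0 ff0; apply/malgP => la; rewrite monalg.mcoeff0.
have [|/mcoeff_outdom //] := boolP (la \in monalg.msupp f).
have pos mu : true -> 0 <= monalg.mcoeff mu f * monalg.mcoeff mu f * psi_norm mu.
  move=> _; apply: mulr_ge0; last exact: ltW (psi_norm_gt0 _ al_gt0).
  by rewrite -expr2 sqr_ge0.
move/eqP: ff0; rewrite /jack_dot -/(psi_norm _) psumr_eq0 // => /allP f0 /f0 /=.
rewrite mulf_eq0 (gt_eqF (psi_norm_gt0 _ al_gt0)) orbF mulf_eq0 orbb.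
by move/eqP.
Qed.

End Dot.

(** * The derivations dual to the power sums *)
Fact is_part_rem (r : nat) (la : intpart) : is_part (rem r la).
Proof.
case: la => s /= /andP[ss s0]; apply/andP; split.
  exact: subseq_sorted geq_trans _ _ (rem_subseq r s) ss.
by apply: contra s0; apply: mem_rem.
Qed.

Definition part_rem (r : nat) (la : intpart) : intpart := IntPart (is_part_rem r la).

(** The partial derivative with respect to the power sum of index [r], on the
    basis of monomials in the power sums. *)
Definition dpsi (r : nat) : symfun -> symfun :=
  lin_ext (fun la => (count_mem r la)%:R *: << part_rem r la >>).

HB.instance Definition _ r := GRing.Linear.on (dpsi r).

Lemma count_cup r (la mu : intpart) :
  count_mem r (part_cup la mu) = (count_mem r la + count_mem r mu)%N.
Proof. by rewrite (seq.permP (perm_cup la mu)) count_cat. Qed.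

Lemma part_rem_cup r (la mu : intpart) : r \in (la : seq nat) ->
  part_rem r (part_cup la mu) = part_cup (part_rem r la) mu.
Proof.
move=> r_la; apply: part_perm; rewrite perm_sym (permPl (perm_cup _ _)) /=.
rewrite -(perm_cons r) -cat_cons.
have h : perm_eq (r :: rem r la ++ mu) (la ++ mu).
  by rewrite -cat_cons perm_cat2r perm_sym perm_to_rem.
rewrite (perm_trans h) // -(permPl (perm_cup la mu)) perm_to_rem //.
by rewrite (perm_mem (perm_cup la mu)) mem_cat r_la.
Qed.

Lemma dpsiU r la : dpsi r << la >> = (count_mem r la)%:R *: << part_rem r la >>.
Proof. exact: lin_extU. Qed.

Lemma dpsiUM r (la mu : intpart) :
  dpsi r (<< la >> * << mu >>) = dpsi r << la >> * << mu >> + << la >> * dpsi r << mu >>.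
Proof.
rewrite symfunU_mul !dpsiU count_cup natrD scalerDl -scalerAl -scalerAr !symfunU_mul.
have -> : (count_mem r la)%:R *: << part_rem r (part_cup la mu) >>
    = (count_mem r la)%:R *: << part_cup (part_rem r la) mu >> :> symfun.
  have [r_la|/count_memPn ->] := boolP (r \in (la : seq nat)); last by rewrite !scale0r.
  by rewrite part_rem_cup.
have [r_mu|/count_memPn ->] := boolP (r \in (mu : seq nat)); last by rewrite !scale0r.
have -> // : part_rem r (part_cup la mu) = part_cup la (part_rem r mu).
by rewrite part_cupC part_rem_cup // part_cupC.
Qed.

Lemma dpsiP r c f g : dpsi r (c *: f + g) = c *: dpsi r f + dpsi r g.
Proof. exact: linearP. Qed.

Lemma dpsiM r f g : dpsi r (f * g) = dpsi r f * g + f * dpsi r g.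
Proof.
elim/symfun_lin_ind: f => [la||c f f' IHf IHf'].
- elim/symfun_lin_ind: g => [mu||c g g' IHg IHg'].
  + exact: dpsiUM.
  + by rewrite !(mulr0, linear0) addr0.
  + rewrite dpsiP !mulrDr -!scalerAr dpsiP IHg IHg'.
    by rewrite scalerDr addrACA.
- by rewrite !(mul0r, linear0) addr0.
rewrite dpsiP !mulrDl -!scalerAl dpsiP IHf IHf'.
by rewrite scalerDr addrACA.
Qed.

Lemma dpsi1 r : dpsi r 1 = 0.
Proof. by rewrite (_ : 1 = << part0 >>) // dpsiU scale0r. Qed.

Lemma dpsi_psum r s : dpsi r.+1 (psum s.+1) = (r == s)%:R.
Proof.
rewrite dpsiU /= eqSS addn0 [s == r]eq_sym; case: eqP => [->|_]; last by rewrite scale0r.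
rewrite scale1r (_ : part_rem _ _ = part0) //.
by apply: val_inj; rewrite /= eqxx.
Qed.

(** The derivative of a product is written with a test on the index, so that
    both sides have the same shape for induction. *)
Lemma dpsi_prod r N (F : 'I_N -> symfun) :
  dpsi r (\prod_(i < N) F i) =
    \sum_(j < N) \prod_(i < N) (if i == j then dpsi r (F i) else F i).
Proof.
elim: N F => [|N IHN] F; first by rewrite !big_ord0 dpsi1.
rewrite big_ord_recl dpsiM IHN [RHS]big_ord_recl.
rewrite [X in _ = X + _]big_ord_recl eqxx /=.
rewrite mulr_sumr; have -> // : \sum_(i < N) F ord0 * \prod_(i0 < N)
     (if i0 == i then dpsi r (F (lift ord0 i0)) else F (lift ord0 i0)) =
  \sum_(i < N) \prod_(i0 < N.+1) (if i0 == lift ord0 i then dpsi r (F i0) else F i0).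
by apply: eq_bigr => j _; rewrite big_ord_recl.
Qed.

Lemma zpart_sup (la : intpart) N : (forall i, (N <= i)%N -> count_mem i la = 0%N) ->
  zpart la = (\prod_(1 <= i < N) (i ^ count_mem i la * (count_mem i la)`!))%N.
Proof.
move=> cN; pose M := maxn N (sumn la).+1.
have E K : (K <= M)%N -> (forall i, (K <= i)%N -> count_mem i la = 0%N) ->
    (\prod_(1 <= i < K) (i ^ count_mem i la * (count_mem i la)`!))%N
     = (\prod_(1 <= i < M) (i ^ count_mem i la * (count_mem i la)`!))%N.
  move=> leKM cK; case: K leKM cK => [|K] leKM cK.
    rewrite big_nil big1_seq // => i _; first by rewrite cK.
  rewrite [RHS](@big_cat_nat _ _ _ K.+1) //= [X in (_ * X)%N]big1_seq ?muln1 // => i /=.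
  by rewrite mem_index_iota => /andP[/cK -> _].
rewrite /zpart [LHS]E ?leq_maxr //; first by rewrite [RHS]E ?leq_maxl.
move=> i lt_i.
apply/count_memPn; apply: contraL lt_i => i_la; rewrite -leqNgt.
elim: (parts la) i_la => //= j s IHs; rewrite inE => /orP[/eqP->|/IHs].
  exact: leq_addr.
by move=> /leq_trans; apply; apply: leq_addl.
Qed.

Lemma zpart_cup1 r (la : intpart) :
  zpart (part_cup (part1 r) la) = (r.+1 * (count_mem r.+1 la).+1 * zpart la)%N.
Proof.
pose N := (r + (sumn la)).+2.
have cE i : count_mem i (part_cup (part1 r) la) = ((r.+1 == i) + count_mem i la)%N.
  by rewrite count_cup /= addn0.
have cN i : (N <= i)%N -> count_mem i la = 0%N.
  move=> le_Ni; apply/count_memPn; apply: contraL le_Ni => i_la; rewrite -ltnNge.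
  suff: (i <= sumn la)%N by rewrite /N; lia.
  elim: (parts la) i_la => //= j s IHs; rewrite inE => /orP[/eqP->|/IHs].
    exact: leq_addr.
  by move=> /leq_trans; apply; apply: leq_addl.
rewrite (@zpart_sup (part_cup _ _) N) => [|i le_Ni]; last first.
  by rewrite cE cN // addn0; case: eqP => // E; move: le_Ni; rewrite -E /N; lia.
rewrite (zpart_sup cN).
have r_in : r.+1 \in index_iota 1 N by rewrite mem_index_iota /N; lia.
rewrite !(bigD1_seq r.+1) ?iota_uniq //= cE eqxx add1n expnS factS.
rewrite (eq_bigr (fun i => (i ^ count_mem i la * (count_mem i la)`!)%N)); last first.
  by move=> i /negbTE ne; rewrite cE eq_sym ne.
by rewrite mulnACA -!mulnA.
Qed.

(** Multiplication by the power sum of index [r] is adjoint to [al * r] times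
    the derivation with respect to it, because z is multiplied by r (m_r + 1)
    when a part r is added. *)
Lemma jack_dot_psum al r f g :
  jack_dot al (psum r.+1 * f) g = al * r.+1%:R * jack_dot al f (dpsi r.+1 g).
Proof.
elim/symfun_lin_ind: f => [la||c f f' IHf IHf']; first last.
- by rewrite mulrDr -scalerAr !jack_dotDl !jack_dotZl IHf IHf'; ring.
- by rewrite mulr0 !jack_dot0l mulr0.
elim/symfun_lin_ind: g => [mu||c g g' IHg IHg']; first last.
- by rewrite dpsiP !jack_dotDr !jack_dotZr IHg IHg'; ring.
- by rewrite linear0 !jack_dot0r mulr0.
rewrite symfunU_mul dpsiU jack_dotZr !jack_dot_psi.
have [r_mu|r_mu] := boolP (r.+1 \in (mu : seq nat)); last first.
  rewrite (count_memPn r_mu) mul0r mulr0.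
  case: eqP => [E|_]; last by rewrite mul0r.
  by move: r_mu; rewrite -E (perm_mem (perm_cup _ _)) inE eqxx.
have E : part_cup (part1 r) (part_rem r.+1 mu) = mu.
  apply: part_perm; rewrite (permPl (perm_cup _ _)) perm_sym.
  exact: perm_to_rem.
have -> : (part_cup (part1 r) la == mu) = (la == part_rem r.+1 mu).
  apply/eqP/eqP => [<-|->//]; rewrite part_rem_cup ?mem_head //.
  rewrite (_ : part_rem _ _ = part0) ?part_cup0p //.
  by apply: val_inj; rewrite /= eqxx.
case: eqP => [->|_]; last by rewrite !(mul0r, mulr0).
have cE : count_mem r.+1 mu = (count_mem r.+1 (part_rem r.+1 mu)).+1.
  by rewrite -{1}E count_cup /= eqxx.
rewrite zpart_cup1 (perm_size (perm_cup _ _)) cE [size (_ ++ _)]/=.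
by rewrite exprS !natrM !mul1r; ring.
Qed.

(** * The generators attached to an exponent *)
Section Generators.
Variable be : rat.

(** The generators of exponent [be]: 1 / al gives the basis dual to the
    monomial functions for the scalar product of parameter [al], and -1 the
    signed elementary functions. *)
Definition hgen (s : nat) : symfun := newton (fun r => be *: psum r) s.

(** On generating series, the derivative of exp (be sum_r p_r t^r / r) with
    respect to p_r is be t^r / r times the series. *)
Lemma dpsi_hgen r s :
  dpsi r.+1 (hgen s) = if (r.+1 <= s)%N then (be / r.+1%:R) *: hgen (s - r.+1) else 0.
Proof.
have [m] := ubnP s; elim: m s => // m IHm [|s] lt_sm; first by rewrite /hgen newton0 dpsi1.
have /(congr1 (dpsi r.+1)) := newtonS (fun r => be *: psum r) s.
rewrite mulr_natl linearMn linear_sum /= -/(hgen _) => Ds.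
have E (i : 'I_s.+1) : dpsi r.+1 (be *: psum i.+1 * hgen (s - i)) =
   ((r == i)%:R * be) *: hgen (s - i) +
    (if (i < s - r)%N then (be / r.+1%:R) *: (be *: psum i.+1 * hgen ((s - r).-1 - i)) else 0).
  rewrite dpsiM IHm; last first.
    exact: leq_ltn_trans (leq_subr _ _) _.
  congr (_ + _).
    by rewrite -[be *: _]addr0 dpsiP dpsi_psum linear0 addr0 mulrC -scalerAr mulr_natr -scaler_nat scalerA mulrC.
  rewrite ltn_subRL [(i < _)%N]ltn_subRL addnC; case: ifP => _; last by rewrite mulr0.
  by rewrite -scalerAr; congr (_ *: (_ * hgen _)); lia.
apply: (@succ_natmul_inj _ s); rewrite [LHS]mulr_natl {}Ds (eq_bigr _ (fun i _ => E i)) big_split /= ltnS.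
have [le_rs|lt_sr] := leqP r s; last first.
  rewrite mulr0 !big1 ?addr0 // => i _; last first.
    by rewrite gtn_eqF ?mul0r ?scale0r // (leq_trans (ltn_ord i)).
  by rewrite ifF //; apply/negbTE; rewrite -leqNgt; lia.
rewrite (bigD1 (Ordinal (le_rs : (r < s.+1)%N))) //= eqxx mul1r big1 ?addr0; last first.
  by move=> i; rewrite -val_eqE eq_sym /= => /negbTE->; rewrite mul0r scale0r.
rewrite subSS -big_mkcond -(big_ord_widen _ (fun i => (be / r.+1%:R) *:
  (be *: psum i.+1 * hgen ((s - r).-1 - i)))) /=; last by lia.
rewrite -scaler_sumr; set t := (s - r)%N.
have -> : \sum_(i < t) be *: psum i.+1 * hgen (t.-1 - i) = t%:R * hgen t.
  case: t => [|t]; first by rewrite big_ord0 mul0r.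
  by rewrite newtonS.
rewrite !mulr_natl -!scaler_nat !scalerA -scalerDl; congr (_ *: _).
have -> : s.+1%:R = r.+1%:R + t%:R :> rat by rewrite -natrD; congr (_%:R); rewrite /t; lia.
by field; rewrite nat1r succ_natr_neq0.
Qed.

Lemma psum_hgen r :
  be *: psum r.+1 = r.+1%:R *: hgen r.+1 - \sum_(i < r) be *: psum i.+1 * hgen (r - i).
Proof.
rewrite scaler_nat -mulr_natl newtonS big_ord_recr /= subnn newton0 mulr1.
by rewrite addrC addrK.
Qed.

End Generators.

(** * The pairing of a product of generators with a symmetric function *)
Section Pairing.
Variables (al be : rat) (N : nat).

Definition hgens (a : 'I_N -> nat) : symfun := \prod_(i < N) hgen be (a i).

Definition Xvar (i : 'I_N) : mpoly N rat := 'X_i.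

(** The value on the multiple [al * be] of an alphabet of [N] letters. *)
Definition pairing_eval (f : symfun) : mpoly N rat :=
  psi_subst (fun r => (al * be) *: powersum Xvar r) f.

Definition expo (a : 'I_N -> nat) : 'X_{1..N} := [multinom a i | i < N].

Lemma mcoeff_Xn_mul (j : 'I_N) r (p : mpoly N rat) (a : 'I_N -> nat) :
  mpoly.mcoeff (expo a) ('X_j ^+ r * p) =
  if (r <= a j)%N then mpoly.mcoeff (expo (fun i => if i == j then (a i - r)%N else a i)) p
  else 0.
Proof.
rewrite mpolyXn mulrC; case: ifP => le_ra.
  rewrite -(mcoeffMX p (U_(j) *+ r)); congr mpoly.mcoeff.
  apply/mnmP => i; rewrite mnmDE mulmnE mnm1E !mnmE eq_sym.
  by case: eqP => [->|]; rewrite ?mul1n ?mul0n ?subnKC ?addn0.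
apply: memN_msupp_eq0; rewrite (perm_mem (msuppMX _ _)).
apply/mapP => -[m _ /mnmP/(_ j)]; rewrite mnmDE mulmnE mnm1E mnmE eqxx mul1n => E.
by move: le_ra; rewrite E leq_addr.
Qed.

Lemma jack_dot1 f : jack_dot al f 1 = psi_subst (fun=> 0 : rat^o) f.
Proof.
elim/symfun_lin_ind: f => [la||c f g IHf IHg]; first last.
- by rewrite jack_dotDl jack_dotZl IHf IHg linearP.
- by rewrite jack_dot0l linear0.
rewrite (_ : 1 = << part0 >>) // jack_dot_psi; elim/symfunU_ind: la => [|r la _].
  by rewrite eqxx /zpart big_nil expr0 !mul1r psi_substE lin_extU /psi_prod big_nil.
rewrite -symfunU_mul rmorphM /= -[<< part1 r >>]/(psum r.+1) psi_subst_psum mul0r.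
case: eqP => [/part_cup_eq0[]|]; last by rewrite mul0r.
by move=> /(congr1 parts).
Qed.

(** The reproducing property of the kernel prod exp (be sum_r p_r z^r / r). It
    follows by induction on the number of power sums in [f]: each is moved to
    the other side as a derivation, which lowers one of the exponents, as does
    the extraction of a coefficient of x_j^r f. *)
Lemma pairingP (a : 'I_N -> nat) f :
  jack_dot al (hgens a) f = mpoly.mcoeff (expo a) (pairing_eval f).
Proof.
elim/symfun_lin_ind: f a => [|a|c f g IHf IHg a]; first last.
- rewrite jack_dotDr jack_dotZr IHf IHg /pairing_eval linearP.
  by rewrite mcoeffD mcoeffZ.
- by rewrite jack_dot0r /pairing_eval linear0 mcoeff0.
elim/symfunU_ind => [|r la IHla] a.
  rewrite (_ : << part0 >> = 1) // /pairing_eval rmorph1 mcoeff1.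
  rewrite jack_dot1 /hgens rmorph_prod /=.
  transitivity (\prod_(i < N) (a i == 0%N)%:R : rat).
    apply: eq_bigr => i _; rewrite /hgen newton_morph -(@newton_zero rat^o).
    by apply: (@eq_newton rat^o) => r; rewrite /= linearZ /= psi_subst_psum scaler0.
  have [a0|] := altP (expo a =P 0%MM).
    by apply: big1 => i _; move/mnmP/(_ i): a0; rewrite mnmE mnm0E => ->.
  rewrite -mdeg_eq0 mdegE sum_nat_eq0 negb_forall => /existsP[i].
  by rewrite mnmE /= => /negbTE a_i; rewrite (bigD1 i) //= a_i mul0r.
rewrite -symfunU_mul -[<< part1 r >>]/(psum r.+1) jack_dotC jack_dot_psum jack_dotC.
rewrite /hgens dpsi_prod.
rewrite jack_dot_suml mulr_sumr /pairing_eval rmorphM /= psi_subst_psum /powersum.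
rewrite -scalerAl mcoeffZ mulr_suml raddf_sum mulr_sumr; apply: eq_bigr => j _.
rewrite {1}/Xvar /= mcoeff_Xn_mul (bigD1 j) //= eqxx dpsi_hgen; case: ifP => le_r; last first.
  by rewrite mul0r jack_dot0l !mulr0.
rewrite -/(pairing_eval _) -IHla -scalerAl jack_dotZl mulrA; congr (_ * _).
  by field; rewrite nat1r succ_natr_neq0.
have -> : hgens (fun i => if i == j then (a i - r.+1)%N else a i) =
    hgen be (a j - r.+1) * \prod_(i < N | i != j) hgen be (a i).
  rewrite /hgens (bigD1 j) //= eqxx.
  by under eq_bigr => i /negbTE-> do [].
by under eq_bigr => i /negbTE-> do [].
Qed.

End Pairing.

(** * Products of generators *)
Section HSeq.
Variable be : rat.

Definition hseq (s : seq nat) : symfun := \prod_(r <- s) hgen be r.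

Lemma hseq_cat s s' : hseq (s ++ s') = hseq s * hseq s'.
Proof. exact: big_cat. Qed.

Lemma hseq_hgens (s : seq nat) :
  hseq s = hgens be (fun i : 'I_(size s) => nth 0%N s i).
Proof. by rewrite /hseq (big_nth 0%N) big_mkord. Qed.

Fact is_part_sort (s : seq nat) : is_part (sort geq [seq r <- s | r != 0%N]).
Proof.
apply/andP; split; first exact: sort_sorted geq_total _.
by rewrite mem_sort mem_filter eqxx.
Qed.

Definition to_part (s : seq nat) : intpart := IntPart (is_part_sort s).

Lemma hseq_to_part s : hseq (to_part s) = hseq s.
Proof.
rewrite /hseq /= (perm_big [seq r <- s | r != 0%N]) ?perm_sort //=.
rewrite big_filter [RHS](bigID (fun r => r != 0%N)) /=.
rewrite [X in _ = _ * X]big1 ?mulr1 // => r; rewrite negbK => /eqP->.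
exact: newton0.
Qed.

Inductive hspan : symfun -> Prop :=
| hspan0 : hspan 0
| hspanD c s f of hspan f : hspan (c *: hseq s + f).

Lemma hspan_lin c f g : hspan f -> hspan g -> hspan (c *: f + g).
Proof.
move=> sf sg; elim: sf => [|c' s f' _ IHf]; first by rewrite scaler0 add0r.
by rewrite scalerDr -addrA scalerA; apply: hspanD.
Qed.

Lemma hspanZ c f : hspan f -> hspan (c *: f).
Proof. by move=> sf; rewrite -[_ *: _]addr0; apply: hspan_lin hspan0. Qed.

Lemma hspan_add f g : hspan f -> hspan g -> hspan (f + g).
Proof. by move=> sf sg; rewrite -[f]scale1r; apply: hspan_lin. Qed.

Lemma hspan_hseq s : hspan (hseq s).
Proof. by rewrite -[hseq s]scale1r -[_ *: _]addr0; apply: hspanD hspan0. Qed.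

Lemma hspan_hgen r : hspan (hgen be r).
Proof.
have -> : hgen be r = hseq [:: r] by rewrite /hseq big_seq1.
exact: hspan_hseq.
Qed.

Lemma hspanM f g : hspan f -> hspan g -> hspan (f * g).
Proof.
move=> sf sg; elim: sf => [|c s f' _ IHf]; first by rewrite mul0r; apply: hspan0.
rewrite mulrDl -scalerAl; apply: hspan_lin => //.
elim: sg => [|c' s' g' _ IHg]; first by rewrite mulr0; apply: hspan0.
by rewrite mulrDr -scalerAr -hseq_cat; apply: hspanD.
Qed.

Hypothesis be0 : be != 0.

(** Newton's recursion is solved for the power sum. *)
Lemma hspan_psum r : hspan (psum r.+1).
Proof.
have [m] := ubnP r; elim: m r => // m IHm r lt_r.
have -> : psum r.+1 = be^-1 *: (be *: psum r.+1) by rewrite scalerA mulVf // scale1r.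
apply: hspanZ; rewrite psum_hgen; apply: hspan_add.
  by apply/hspanZ/hspan_hgen.
rewrite -scaleN1r; apply: hspanZ; elim/big_ind: _ => [|f g|i _].
- exact: hspan0.
- exact: hspan_add.
rewrite -scalerAl; apply/hspanZ/hspanM; first by apply: IHm; apply: leq_trans (ltn_ord i) _.
exact: hspan_hgen.
Qed.

Lemma hspan_all f : hspan f.
Proof.
elim/symfun_lin_ind: f => [la||c f g]; last 2 first.
- exact: hspan0.
- exact: hspan_lin.
elim/symfunU_ind: la => [|r la IHla].
  have -> : << part0 >> = hseq [::] by rewrite /hseq big_nil.
  exact: hspan_hseq.
by rewrite -symfunU_mul; apply: hspanM => //; apply: (hspan_psum r).
Qed.

(** A function orthogonal to a spanning family is orthogonal to itself. *)
Lemma dot_hseq_eq0 al f : 0 < al -> (forall mu : intpart, jack_dot al (hseq mu) f = 0) -> f = 0.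
Proof.
move=> al_gt0 f0; apply: (jack_dot_definite al_gt0).
elim: {1}f / (hspan_all f) => [|c s g _ IHg]; first exact: jack_dot0l.
by rewrite jack_dotDl jack_dotZl -hseq_to_part f0 mulr0 add0r.
Qed.

End HSeq.

Lemma eq_psi_subst (A : comAlgType rat) (psi psi' : nat -> A) :
  (forall r, psi r.+1 = psi' r.+1) -> psi_subst psi =1 psi_subst psi'.
Proof.
move=> eqp f; rewrite !psi_substE; apply: eq_bigr => la _; congr (_ *: _).
rewrite /psi_prod !big_seq; apply: eq_bigr => -[|r] r_la; last exact: eqp.
by case: la r_la => s /= /andP[_ /negP].
Qed.

(** * Coefficients of monomials *)
Section Coefficients.
Variable al : rat.
Hypothesis al_gt0 : 0 < al.

(** The coefficient of the monomial function of [mu] in [f], as a scalar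
    product: see [mon_coefE]. In this form it does not depend on a number of
    letters. *)
Definition mon_coef (f : symfun) (mu : intpart) : rat := jack_dot al (hseq al^-1 mu) f.

Definition part_exp (mu : intpart) : 'X_{1..size mu} := expo (fun i => nth 0%N mu i).

Lemma mon_coefE f mu :
  mon_coef f mu = mpoly.mcoeff (part_exp mu) (sf_eval (@Xvar (size mu)) f).
Proof.
rewrite /mon_coef hseq_hgens pairingP; congr mpoly.mcoeff; apply: eq_psi_subst => r.
by rewrite mulfV ?scale1r // gt_eqF.
Qed.

Lemma mon_coefB f g mu : mon_coef (f - g) mu = mon_coef f mu - mon_coef g mu.
Proof. exact: jack_dotBr. Qed.
Lemma mon_coefZ c f mu : mon_coef (c *: f) mu = c * mon_coef f mu.
Proof. exact: jack_dotZr. Qed.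

Lemma mon_coef_inj f : (forall mu, mon_coef f mu = 0) -> f = 0.
Proof. by apply: dot_hseq_eq0 => //; rewrite invr_eq0 gt_eqF. Qed.

Lemma mcoeff_monomial_eval (mu nu : intpart) :
  mpoly.mcoeff (part_exp mu) (monomial_eval (@Xvar (size mu)) nu) = (mu == nu)%:R.
Proof.
pose m (e : {ffun 'I_(size mu) -> 'I_(sumn nu).+1}) : 'X_{1..size mu} :=
  expo (fun i => val (e i)).
rewrite raddf_sum /= (eq_bigr (fun e => (m e == part_exp mu)%:R)) => [|e _]; last first.
  by rewrite /Xvar -mcoeffX mpolyXE_id; congr mpoly.mcoeff; apply: eq_bigr => i _; rewrite mnmE.
have mP e : m e = part_exp mu -> [seq val (e i) | i <- enum 'I_(size mu)] = mu.
  move=> E; apply: (@eq_from_nth _ 0%N); rewrite size_map size_enum_ord // => i lt_i.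
  rewrite (nth_map (Ordinal lt_i)) ?size_enum_ord //.
  have := congr1 (fun u : 'X_{1..size mu} => u (nth (Ordinal lt_i) (enum 'I_(size mu)) i)) E.
  by rewrite !mnmE nth_enum_ord.
have mu_filter : [seq r <- mu | r != 0%N] = mu.
  by apply/all_filterP/allP => r r_mu; case: mu r_mu {m mP} => s /= /andP[_ /negP s0] rs; apply: contraPneq s0 => <-.
have [E|ne] := eqVneq mu nu; last first.
  rewrite big1 // => e pe; case: eqP => // /mP E; case/eqP: ne; apply: part_perm.
  by move: pe; rewrite E mu_filter.
subst nu; have part_le i : (nth 0%N mu i < (sumn mu).+1)%N.
  rewrite ltnS; elim: (parts mu) i => [|x s IHs] [|i] //=; first exact: leq_addr.
  exact: leq_trans (IHs i) (leq_addl _ _).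
pose e0 : {ffun 'I_(size mu) -> 'I_(sumn mu).+1} := [ffun i => Ordinal (part_le (val i))].
have e0E : m e0 = part_exp mu by apply/mnmP => i; rewrite !mnmE ffunE.
rewrite (bigD1 e0) /=; last by rewrite (mP _ e0E) mu_filter.
rewrite e0E eqxx big1 ?addr0 // => e /andP[_ ne]; case: eqP => // E.
case/eqP: ne; apply/ffunP => i; apply: val_inj; rewrite ffunE /=.
by have := congr1 (fun u : 'X_{1..size mu} => u i) E; rewrite !mnmE.
Qed.

Lemma unitriangular_coef la f mu : unitriangular la f ->
  mon_coef f la = 1 /\ (mon_coef f mu != 0 -> mu = la \/ sdominated mu la).
Proof.
case=> s [u [s_lt fE]].
have cE nu : mon_coef f nu = (nu == la)%:R + \sum_(mu <- s) u mu * (nu == mu)%:R.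
  rewrite mon_coefE [sf_eval _ _](fE (size nu)) mcoeffD; congr (_ + _).
    exact: mcoeff_monomial_eval.
  rewrite raddf_sum /=; apply: eq_bigr => mu' _; rewrite mcoeffZ; congr (_ * _).
  exact: mcoeff_monomial_eval.
split; rewrite cE.
  rewrite eqxx big1_seq ?addr0 // => nu /andP[_ /s_lt[_ ne]].
  by case: eqP ne => [->|]; rewrite ?mulr0.
have [->|_] := eqVneq mu la; [by left|rewrite add0r => ne0; right].
have [/s_lt //|mu_s] := boolP (mu \in s).
case/eqP: ne0; rewrite big1_seq // => nu /andP[_ nu_s].
by case: eqP => [E|_]; rewrite ?mulr0 //; rewrite E nu_s in mu_s.
Qed.

End Coefficients.

(** * Dominance order *)
Lemma part_neq0 (mu : intpart) r : r \in (mu : seq nat) -> (0 < r)%N.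
Proof. by case: mu => s /= /andP[_ s0] rs; rewrite lt0n; apply: contraNneq s0 => <-. Qed.

Lemma size_part (mu : intpart) : (size mu <= sumn mu)%N.
Proof.
have := @part_neq0 mu; elim: (parts mu) => //= r s IHs pos.
rewrite -add1n leq_add ?pos ?mem_head // IHs // => t ts.
by apply: pos; rewrite inE ts orbT.
Qed.

Lemma leq_nth_sumn (s : seq nat) i : (nth 0%N s i <= sumn s)%N.
Proof.
elim: s i => [|r s IHs] [|i] //=; first exact: leq_addr.
exact: leq_trans (IHs i) (leq_addl _ _).
Qed.

Lemma sumn_takeS (s : seq nat) i : sumn (take i.+1 s) = (sumn (take i s) + nth 0%N s i)%N.
Proof.
have [lt_i|le_i] := ltnP i (size s); first by rewrite (take_nth 0%N lt_i) sumn_rcons.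
by rewrite !take_oversize ?nth_default ?addn0 // leqW.
Qed.

Lemma part_eq_nth (mu nu : intpart) : (forall i, nth 0%N mu i = nth 0%N nu i) -> mu = nu.
Proof.
move=> eqn; apply: val_inj => /=; apply: (@eq_from_nth _ 0%N) => //.
have le (a b : intpart) : (forall i, nth 0%N a i = nth 0%N b i) -> (size a <= size b)%N.
  move=> eqab; rewrite leqNgt; apply/negP => lt; have := @part_neq0 a _ (mem_nth 0%N lt).
  by rewrite eqab nth_default.
by apply/eqP; rewrite eqn_leq !le.
Qed.

(** The sum of the partial sums. The bound [d] is meant to be at least the
    number of parts. *)
Definition rank d (mu : seq nat) : nat := (\sum_(i < d.+1) sumn (take i mu))%N.

Lemma dominated_rank d mu nu : dominated mu nu -> (rank d mu <= rank d nu)%N.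
Proof. by case=> _ le; apply: leq_sum => i _. Qed.

(** The rank is strictly monotone for dominance, hence gives a linear extension
    to do induction on. *)
Lemma dominated_rank_eq (mu nu : intpart) : dominated mu nu ->
  rank (sumn nu) mu = rank (sumn nu) nu -> mu = nu.
Proof.
case=> eq_d le /eqP; rewrite eq_sym /rank => /eqP E.
have take_eq i : (i <= sumn nu)%N -> sumn (take i mu) = sumn (take i nu).
  move=> le_i; have := leqif_sum (fun (j : 'I_(sumn nu).+1) (_ : true) => leqif_eq (le j)).
  move/leqifP; rewrite -E; case: ifP => [/forallP h _|]; last by rewrite ltnn.
  by apply/eqP; have := h (Ordinal (le_i : (i < (sumn nu).+1)%N)).
have take_eq' i : sumn (take i mu) = sumn (take i nu).
  have [/take_eq//|lt_i] := leqP i (sumn nu).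
  rewrite !take_oversize //; first exact: leq_trans (size_part _) (ltnW _).
  by rewrite (leq_trans (size_part _)) // eq_d ltnW.
apply: part_eq_nth => i; have := take_eq' i.+1; rewrite !sumn_takeS take_eq'.
exact: addnI.
Qed.

Lemma sdominated_rank (mu nu : intpart) :
  sdominated mu nu -> (rank (sumn nu) mu < rank (sumn nu) nu)%N.
Proof.
case=> dom ne; rewrite ltn_neqAle dominated_rank // andbT.
by apply/eqP => /(dominated_rank_eq dom).
Qed.

Lemma dominated_trans mu nu la : dominated mu nu -> dominated nu la -> dominated mu la.
Proof. by move=> [e1 h1] [e2 h2]; split=> [|i]; [rewrite e1 | exact: leq_trans (h1 i) _]. Qed.

Lemma sdominated_trans (mu nu la : intpart) :
  dominated mu nu -> sdominated nu la -> sdominated mu la.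
Proof.
move=> dmn [dnl ne]; split; first exact: dominated_trans dnl.
move=> E; have := sdominated_rank (conj dnl ne); rewrite ltnNge => /negP; apply.
by rewrite -{2}E dominated_rank.
Qed.

(** Contains all the partitions of [d]: a finite range for the sums over
    partitions. *)
Definition parts_of (d : nat) : seq intpart :=
  undup [seq to_part [seq val (f i) | i <- enum 'I_d] | f : {ffun 'I_d -> 'I_d.+1}].

Lemma mem_parts_of d (mu : intpart) : sumn mu = d -> mu \in parts_of d.
Proof.
move=> sum_mu; rewrite mem_undup; apply/mapP.
have lt_nth (i : nat) : (nth 0%N mu i < d.+1)%N by rewrite ltnS -sum_mu leq_nth_sumn.
exists [ffun i : 'I_d => Ordinal (lt_nth i)]; first by rewrite mem_enum.
apply: part_perm; rewrite perm_sym /= perm_sort.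
have -> : [seq val ([ffun i : 'I_d => Ordinal (lt_nth i)] i) | i <- enum 'I_d]
    = mu ++ nseq (d - size mu) 0%N.
  have le_d : (size mu <= d)%N by rewrite -sum_mu size_part.
  apply: (@eq_from_nth _ 0%N).
    by rewrite size_map size_enum_ord size_cat size_nseq subnKC.
  move=> i; rewrite size_map size_enum_ord => lt_i.
  rewrite (nth_map (Ordinal lt_i)) ?size_enum_ord // ffunE /= nth_enum_ord //.
  rewrite nth_cat; case: ltnP => // le_i.
  by rewrite nth_nseq if_same nth_default.
rewrite filter_cat [X in _ ++ X](_ : _ = [::]) ?cats0; last first.
  by apply/eqP; rewrite -[_ == _]negbK -has_filter; apply/hasPn => r /nseqP[-> _].
by rewrite (all_filterP _) //; apply/allP => r /part_neq0; rewrite lt0n.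
Qed.

Section Triangular.
Variables (al : rat) (P : intpart -> symfun).
Hypothesis al_gt0 : 0 < al.
Hypothesis hP : is_jack al P.

Local Notation mon_coef := (@mon_coef al).

Lemma jack_coef1 la : mon_coef (P la) la = 1.
Proof. by case: (unitriangular_coef al_gt0 la (hP.2 la)). Qed.

Lemma jack_coef_dominated la mu : mon_coef (P la) mu != 0 -> dominated mu la.
Proof.
move=> ne0; case: (unitriangular_coef al_gt0 mu (hP.2 la)) => _ /(_ ne0)[->|[]//].
by split.
Qed.

(** By induction on a bound for the rank of the monomials of [w]: those of the
    highest rank are cancelled by subtracting Jack polynomials, which leaves
    the scalar product unchanged. The base case is that a symmetric function
    without monomials is zero. *)
Lemma ortho_below la f :
    (forall mu, sdominated mu la -> jack_dot al f (P mu) = 0) ->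
  forall w, (forall mu, mon_coef w mu != 0 -> sdominated mu la) -> jack_dot al f w = 0.
Proof.
move=> fP w w_below; pose d := sumn la.
suff main b : forall w, (forall mu, mon_coef w mu != 0 -> sdominated mu la /\ (rank d mu < b)%N) ->
    jack_dot al f w = 0.
  apply: (main (rank d la)) => mu /w_below mu_la; split=> //.
  exact: sdominated_rank.
elim: b => [|b IHb] {w_below} {}w w_lt.
  rewrite (_ : w = 0) ?jack_dot0r //; apply: (mon_coef_inj al_gt0) => mu.
  by apply/eqP; apply/negPn/negP => /w_lt[].
pose w' := w - \sum_(nu <- parts_of d | rank d nu == b) mon_coef w nu *: P nu.
have fw' : jack_dot al f w' = jack_dot al f w.
  rewrite /w' jack_dotBr jack_dot_sumr big1 ?subr0 // => nu _; rewrite jack_dotZr.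
  have [->|/w_lt[nu_la _]] := eqVneq (mon_coef w nu) 0; first by rewrite mul0r.
  by rewrite fP ?mulr0.
rewrite -fw'; apply: IHb => mu.
have cw' : mon_coef w' mu = mon_coef w mu -
    \sum_(nu <- parts_of d | rank d nu == b) mon_coef w nu * mon_coef (P nu) mu.
  rewrite /w' mon_coefB; congr (_ - _); rewrite /mon_coef jack_dot_sumr.
  by apply: eq_bigr => nu _; rewrite jack_dotZr.
have term nu : mon_coef w nu * mon_coef (P nu) mu != 0 -> dominated mu nu /\ sdominated nu la.
  by rewrite mulf_eq0 negb_or => /andP[/w_lt[nu_la _] /jack_coef_dominated].
move=> ne0; split.
  have [/w_lt[]//|/negPn/eqP w_mu] := boolP (mon_coef w mu != 0).
  have [/hasP[nu _ /term[]]|/hasPn all0] :=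
      boolP (has (fun nu => mon_coef w nu * mon_coef (P nu) mu != 0) (parts_of d)).
    exact: sdominated_trans.
  case/eqP: ne0; rewrite cw' w_mu sub0r big1_seq ?oppr0 // => nu /andP[_ /all0].
  by rewrite negbK => /eqP.
rewrite ltnNge; apply: contra ne0 => le_b; rewrite cw' subr_eq0.
have term0 (nu : intpart) : rank d nu = b -> nu != mu -> mon_coef w nu * mon_coef (P nu) mu = 0.
  move=> rk ne; apply/eqP/negPn/negP => /term[dom [[sum_nu _] _]]; move: le_b ne.
  rewrite -rk /d -sum_nu => le_nm; case/eqP; apply: esym.
  by apply: dominated_rank_eq => //; apply/eqP; rewrite eqn_leq le_nm dominated_rank.
have [rk|ne_rk] := eqVneq (rank d mu) b; last first.
  rewrite big1_seq => [|nu /andP[/eqP rk _]]; last first.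
    by apply: term0 => //; apply: contraNneq ne_rk => <-; apply/eqP.
  by apply: contraNT ne_rk => /w_lt[_]; rewrite ltnS => le; rewrite eqn_leq le.
have [mu_d|mu_d] := boolP (mu \in parts_of d).
  rewrite big_mkcond (bigD1_seq mu) ?undup_uniq //= rk eqxx jack_coef1 mulr1.
  rewrite big1 ?addr0 // => nu ne; case: eqP => // rk'; exact: term0.
rewrite big1_seq => [|nu /andP[/eqP rk' nu_d]]; last first.
  by apply: term0 => //; apply: contraNneq mu_d => <-.
by apply: contraNT mu_d => /w_lt[[[sum_mu _] _] _]; apply: mem_parts_of.
Qed.

End Triangular.

(** * Elementary symmetric polynomials *)
Lemma newton_mesym n s :
  newton (fun r => - \sum_(i < n) ('X_i : mpoly n rat) ^+ r) s = (-1) ^+ s *: mesym n rat s.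
Proof.
pose cs : n.-tuple (mpoly n rat) := [tuple 'X_i | i < n].
have csE (A : pzSemiRingType) (F : mpoly n rat -> A) : \prod_(c <- cs) F c = \prod_(i < n) F 'X_i.
  by rewrite big_tuple; apply: eq_bigr => i _; rewrite tnth_mktuple.
have -> : newton (fun r => - \sum_(i < n) ('X_i : mpoly n rat) ^+ r) s =
    (\prod_(c <- cs) (1 - c *: 'X) : {poly mpoly n rat})`_s.
  by rewrite newton_prod csE.
have [le_s|lt_s] := leqP s n; last first.
  rewrite nth_default ?mesym_geqnE ?scaler0 //.
  by rewrite (leq_trans (size_prod_1subX _)) // size_tuple.
have := @prod_XsubC_rev _ cs (n - s); rewrite size_tuple leq_subr subKn // => /(_ isT) <-.
rewrite (mroots_coeff cs (Ordinal (le_s : (s < n.+1)%N))) /= -mul_mpolyC rmorphXn rmorphN rmorph1.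
congr (_ * _); rewrite !mesymE rmorph_sum; apply: eq_bigr => h _.
rewrite /= mevalX [RHS]mpolyXE_id; apply: eq_bigr => i _.
by rewrite tnth_mktuple.
Qed.

Section Rectangular.
Variables (N k : nat).
Local Notation n := N.+1.
Let al : rat := k.+1%:R.
Let al_gt0 : 0 < al. Proof. exact: ltr0Sn. Qed.
Local Notation mon_coef := (@mon_coef al).
Local Notation g := (hgen al^-1).

Definition multi_eval (f : symfun) : mpoly n rat :=
  psi_subst (fun r => (al * -1) *: powersum (@Xvar n) r) f.

HB.instance Definition _ := GRing.Linear.copy multi_eval
  (psi_subst (fun r => (al * -1) *: powersum (@Xvar n) r)).
HB.instance Definition _ := GRing.RMorphism.copy multi_eval
  (psi_subst (fun r => (al * -1) *: powersum (@Xvar n) r)).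

Lemma multi_evalP c f h : multi_eval (c *: f + h) = c *: multi_eval f + multi_eval h.
Proof. exact: linearP. Qed.

Lemma multi_eval_g s : multi_eval (g s) = (-1) ^+ s *: mesym n rat s.
Proof.
rewrite -newton_mesym newton_morph; apply: eq_newton => r /=.
by rewrite linearZ /= [multi_eval _]psi_subst_psum scalerA mulrA mulVf ?gt_eqF // mul1r scaleN1r.
Qed.

(** Polynomials in the first [n] generators of exponent 1 / al. The signs make
    their values at minus [al] times the alphabet of [n] letters polynomials in
    the elementary symmetric functions. *)
Definition low_gen (p : mpoly n rat) : symfun :=
  mpoly.mmap (in_alg symfun) (fun i : 'I_n => (-1) ^+ i.+1 *: g i.+1) p.

Lemma multi_eval_low_gen p : multi_eval (low_gen p) = p \mPo [tuple mesym n rat i.+1 | i < n].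
Proof.
rewrite /low_gen /mpoly.mmap rmorph_sum comp_mpolyE; apply: eq_bigr => m _.
rewrite /= mulr_algl linearZ /= rmorph_prod; congr (_ *: _); apply: eq_bigr => i _.
rewrite rmorphXn /= linearZ /= multi_eval_g scalerA -exprD addnn -mul2n exprM sqrrN !expr1n.
by rewrite scale1r tnth_mktuple.
Qed.

(** The kernel of the evaluation is the ideal of the generators of index
    greater than [n]: these vanish, and the values of the others are
    algebraically independent. The hypothesis on [w] says that it is orthogonal
    to this ideal, or that no monomial of [w] has an exponent greater than [n].
    *)
Lemma multi_eval_ker f w : multi_eval f = 0 ->
  (forall s, has (fun r => n < r)%N s -> jack_dot al (hseq al^-1 s) w = 0) ->
  jack_dot al f w = 0.
Proof.
move=> f0 w0; have al'0 : al^-1 != 0 by rewrite invr_eq0 gt_eqF.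
have [p [pf dot_p]] : exists p, multi_eval f = multi_eval (low_gen p) /\
    jack_dot al f w = jack_dot al (low_gen p) w.
  elim: f / (hspan_all al'0 f) {f0} => [|c s f _ [p [pf dot_p]]].
    by exists 0; rewrite /low_gen mmap0.
  have [big_s|] := boolP (has (fun r => n < r)%N s).
    exists p; split; last by rewrite jack_dotDl jack_dotZl w0 // mulr0 add0r.
    rewrite multi_evalP pf (_ : multi_eval (hseq _ s) = 0) ?scaler0 ?add0r //.
    case/hasP: big_s => r rs lt_r; rewrite /hseq rmorph_prod (big_rem r) //=.
    by rewrite multi_eval_g mesym_geqnE // scaler0 mul0r.
  rewrite -all_predC => /allP small_s.
  pose q : mpoly n rat := \prod_(r <- s) (if r is r'.+1 then (-1) ^+ r *: 'X_(inord r') else 1).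
  have qE : low_gen q = hseq al^-1 s.
    rewrite /low_gen rmorph_prod /hseq !big_seq; apply: eq_bigr => -[|r] /small_s /=.
      by rewrite rmorph1 /hgen newton0.
    rewrite -leqNgt => lt_r; rewrite mmapZ mpoly.mmapX mmap1U mulr_algl inordK //.
    by rewrite scalerA -exprD addnn -mul2n exprM sqrrN !expr1n scale1r.
  exists (c *: q + p).
  have -> : low_gen (c *: q + p) = c *: hseq al^-1 s + low_gen p.
    by rewrite /low_gen mmapD mmapZ mulr_algl -[mpoly.mmap _ _ q]/(low_gen q) qE.
  by rewrite !multi_evalP pf !jack_dotDl dot_p.
move: pf; rewrite f0 multi_eval_low_gen => /esym/msym_fundamental_un0 p0.
by rewrite dot_p p0 /low_gen mmap0 jack_dot0l.
Qed.

(** The function that will be identified with a multiple of the rectangular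
    Jack polynomial. *)
Definition rect_sym : symfun := disc_subst k (fun _ : 'I_n => shift (hgen (-1)) N).

Lemma rect_sym_multi : multi_eval rect_sym = disc_subst k (fun _ : 'I_n => shift (multi_complete N k) N).
Proof.
rewrite /rect_sym disc_subst_morph; apply: eq_bigr => m _; congr (_ *: _).
apply: eq_bigr => i _; rewrite /shift; case: ifP => _; last exact: raddf0.
rewrite /hgen newton_morph; apply: eq_newton => r.
rewrite /= linearZ /= [multi_eval _]psi_subst_psum scalerA mulrN1 mulN1r opprK.
by rewrite /al scaler_nat.
Qed.

Lemma size_rect : size (rect_part n k) = (N * k)%N.
Proof. by rewrite size_nseq. Qed.

Lemma hseq_rect be : hseq be (rect_part n k) = hgen be n ^+ (N * k).
Proof. by rewrite /hseq big_nseq iter_mulr_1. Qed.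

(** On minus [al] times the alphabet, [rect_sym] is a multiple of a power of
    the product of the letters, and so is a power of the generator of index
    [n]. The two differ by an element of the kernel of the evaluation, and the
    scalar product with this power extracts the coefficient of the rectangular
    monomial. *)
Lemma rect_sym_dot : exists c, forall w,
    (forall s, has (fun r => n < r)%N s -> jack_dot al (hseq al^-1 s) w = 0) ->
  jack_dot al rect_sym w = c * mon_coef w (rect_part n k).
Proof.
pose mL : 'X_{1..n} := [multinom (N * k)%N | _ < n].
pose Phi := disc_subst k (fun _ : 'I_n => shift (multi_complete N k) N).
have PhiE : Phi = mpoly.mcoeff mL Phi *: 'X_[mL].
  apply/mpolyP => m; rewrite mcoeffZ mcoeffX eq_sym.
  have [->|ne] := eqVneq m mL; first by rewrite mulr1.
  by rewrite mulr0; apply/eqP/negPn/negP => /disc_subst_multi_supp E; rewrite E eqxx in ne.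
pose c := mpoly.mcoeff mL Phi * (-1) ^+ (n * (N * k)).
exists c => w w0; apply/eqP; rewrite -subr_eq0 /mon_coef -jack_dotZl -jack_dotBl; apply/eqP.
apply: multi_eval_ker => //; rewrite linearB linearZ /= rect_sym_multi -/Phi {1}PhiE.
rewrite hseq_rect rmorphXn /= multi_eval_g mesymnnE.
have -> : 'X_[mL] = (\prod_(i < n) 'X_i) ^+ (N * k) :> mpoly n rat.
  by rewrite mpolyXE_id -prodrXl; apply: eq_bigr => i _; rewrite mnmE.
rewrite exprZn -exprM scalerA /c -mulrA -exprD addnn -mul2n.
by rewrite [(-1) ^+ (2 * _)]exprM sqrrN !expr1n mulr1 subrr.
Qed.

End Rectangular.

(** * Identification with the rectangular Jack polynomial *)
Section Identification.
Variables (N k : nat).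
Local Notation n := N.+1.
Local Notation al := (k.+1%:R : rat).
Let al_gt0 : 0 < al. Proof. exact: ltr0Sn. Qed.
Local Notation mon_coef := (@mon_coef al).
Local Notation la := (rect_part n k).

(** By symmetry of the scalar product the generators dual to the monomials are
    evaluated on an alphabet of [n] letters, where only finitely many are
    nonzero. *)
Lemma mon_coef_rect_sym mu :
  mon_coef (rect_sym N k) mu = \sum_(m <- mpoly.msupp (disc_power n k)) mpoly.mcoeff m (disc_power n k) *
    (if [forall i, N <= m i]%N
     then mpoly.mcoeff (expo (fun i => m i - N)%N) (multi_eval N k (hseq al^-1 mu)) else 0).
Proof.
rewrite /mon_coef jack_dot_sumr; apply: eq_bigr => m _; rewrite jack_dotZr; congr (_ * _).
case: ifP => [/forallP le_m|/forallPn[i lt_m]]; last first.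
  by rewrite (bigD1 i) //= /shift (negbTE lt_m) mul0r jack_dot0r.
rewrite jack_dotC (_ : multi_eval N k = @pairing_eval al (-1) n) // -pairingP /hgens.
by rewrite (eq_bigr (fun i => hgen (-1) (m i - N))) // => i _; rewrite /shift le_m.
Qed.

Lemma multi_eval_hseq s :
  multi_eval N k (hseq al^-1 s) = \prod_(r <- s) ((-1) ^+ r *: mesym n rat r).
Proof. by rewrite rmorph_prod; apply: eq_bigr => r _; apply: multi_eval_g. Qed.

Lemma homogen_mesym r : homogen r (mesym n rat r).
Proof. by move=> m; rewrite -mcoeff_msupp mem_msupp_mesym => /andP[/eqP]. Qed.

(** The rectangle is the largest partition of its size whose parts do not
    exceed [n]. *)
Lemma dominated_rect (mu : intpart) : sumn mu = (n * (N * k))%N -> all (fun r => r <= n)%N mu ->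
  dominated mu la.
Proof.
move=> sum_mu /allP le_mu; split; first by rewrite sum_mu /= sumn_nseq.
move=> i; have [le_i|lt_i] := leqP (N * k) i.
  rewrite [take i la]take_oversize ?size_rect //= sumn_nseq -sum_mu.
  by rewrite -{2}(cat_take_drop i mu) sumn_cat leq_addr.
have -> : sumn (take i la) = (n * i)%N by rewrite /= take_nseq ?sumn_nseq // ltnW.
have : all (fun r => r <= n)%N (take i mu).
  by apply/allP => r /mem_take; apply: le_mu.
have : (size (take i mu) <= i)%N by rewrite size_take_min geq_minl.
move: (take i mu) => s; elim: s i {lt_i} => [|r s IHs] [|i] //= le_s /andP[le_r le_rs].
by rewrite mulnS leq_add // IHs.
Qed.

Lemma dominated_rect_le (nu : intpart) r : dominated nu la -> r \in (nu : seq nat) -> (r <= n)%N.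
Proof.
case=> _ /(_ 1%N); case: nu => -[|h t] //= /andP[st _]; rewrite take0 addn0 => le_h.
have {le_h} le_h : (h <= n)%N.
  by apply: leq_trans le_h _; case: (N * k)%N => //= ?; rewrite take0 addn0.
rewrite inE => /orP[/eqP-> //|]; move: st => /(order_path_min geq_trans)/allP st /st.
by move/leq_trans; apply.
Qed.

Lemma mon_coef_rect_sym_dominated mu : mon_coef (rect_sym N k) mu != 0 -> dominated mu la.
Proof.
rewrite mon_coef_rect_sym => ne0.
have [/hasP[m m_disc]|/hasPn all0] := boolP (has (fun m : 'X_{1..n} =>
    [forall i, N <= m i]%N && (mpoly.mcoeff (expo (fun i => m i - N)%N)
      (multi_eval N k (hseq al^-1 mu)) != 0)) (mpoly.msupp (disc_power n k))); last first.
  case/eqP: ne0; rewrite big1_seq // => m /andP[_ /all0]; rewrite negb_and negbK.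
  by case: ifP => _ /=; rewrite ?mulr0 // => /eqP->; rewrite mulr0.
rewrite multi_eval_hseq => /andP[/forallP le_m ne_m].
have deg_m : mdeg m = (n * (N * k.+1))%N.
  by apply: homogen_disc_power; rewrite -mcoeff_msupp.
apply: dominated_rect.
  have hom : homogen (\sum_(r <- mu) r) (\prod_(r <- mu) ((-1) ^+ r *: mesym n rat r)).
    by apply: homogen_prod => r _; apply/homogenZ/homogen_mesym.
  rewrite sumnE -(hom _ ne_m) mdegE.
  rewrite (eq_bigr (fun i => m i - N)%N) => [|i _]; last by rewrite mnmE.
  by rewrite sumnB // -mdegE deg_m sum_nat_const card_ord; nia.
apply/allP => r r_mu; rewrite leqNgt; apply: contra ne_m => lt_r.
by rewrite (big_rem r) //= mesym_geqnE // scaler0 mul0r mcoeff0.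
Qed.

(** The generator of index [n] has value the product of the letters up to sign,
    so that a single coefficient of the product of differences remains, the
    constant term of Dyson. *)
Lemma mon_coef_rect_sym_rect : mon_coef (rect_sym N k) la = (n * k.+1)`!%:R / (k.+1)`!%:R ^+ n.
Proof.
rewrite mon_coef_rect_sym -dyson_coef; set m0 := [multinom _ | _ < _].
have -> : multi_eval N k (hseq al^-1 la) = 'X_[[multinom (N * k)%N | _ < n]].
  rewrite hseq_rect rmorphXn /= multi_eval_g mesymnnE exprZn -exprM.
  have -> : (-1) ^+ (n * (N * k)) = 1 :> rat.
    by rewrite -signr_odd mulnA oddM oddM /= andNb.
  by rewrite scale1r mpolyXE_id -prodrXl; apply: eq_bigr => i _; rewrite mnmE.
have term (m : 'X_{1..n}) : (if [forall i, N <= m i]%N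
     then mpoly.mcoeff (expo (fun i => m i - N)%N)
       ('X_[[multinom (N * k)%N | _ < n]] : mpoly n rat) else 0) = (m == m0)%:R.
  rewrite mcoeffX; have [->|ne] := eqVneq m m0.
    rewrite ifT; last by apply/forallP => i; rewrite mnmE leq_addr.
    by rewrite (_ : expo _ = [multinom (N * k)%N | _ < n]) ?eqxx //; apply/mnmP => i; rewrite !mnmE addKn.
  case: ifP => // /forallP le_m; case: eqP => // /mnmP E; case/eqP: ne.
  by apply/mnmP => i; have := E i; rewrite !mnmE => ->; rewrite subnKC.
rewrite (eq_bigr (fun m => mpoly.mcoeff m (disc_power n k) * (m == m0)%:R)) => [|m _]; last first.
  by rewrite term.
have [m0_in|m0_out] := boolP (m0 \in mpoly.msupp (disc_power n k)).
  rewrite (bigD1_seq m0) ?msupp_uniq //= eqxx mulr1 big1 ?addr0 // => m /negbTE->.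
  by rewrite mulr0.
rewrite (memN_msupp_eq0 m0_out) big1_seq // => m /andP[_ m_in].
by case: eqP m_in m0_out => [->->|_]; rewrite ?mulr0.
Qed.

(** The difference of the two sides has only monomials below the rectangle, and
    is orthogonal to the Jack polynomials below the rectangle: hence it is
    orthogonal to itself. *)
Lemma rect_sym_jack (P : intpart -> symfun) : is_jack al P ->
  rect_sym N k = ((n * k.+1)`!%:R / (k.+1)`!%:R ^+ n) *: P la.
Proof.
move=> hP; set c := _ / _; apply/eqP; rewrite -subr_eq0; apply/eqP.
pose f := rect_sym N k - c *: P la.
have P_rank mu : sdominated mu la -> mon_coef (P mu) la = 0.
  move=> mu_la; apply/eqP/negPn/negP => /(jack_coef_dominated al_gt0 hP) la_mu.
  by have [] := sdominated_trans la_mu mu_la.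
have f_below mu : mon_coef f mu != 0 -> sdominated mu la.
  move=> ne0; have ne : mu <> la.
    move=> E; case/eqP: ne0; rewrite E mon_coefB mon_coefZ mon_coef_rect_sym_rect.
    by rewrite (jack_coef1 al_gt0 hP) mulr1 subrr.
  split=> //; have [E|] := eqVneq (mon_coef (P la) mu) 0; last first.
    exact: jack_coef_dominated.
  by apply: mon_coef_rect_sym_dominated; move: ne0; rewrite mon_coefB mon_coefZ E mulr0 subr0.
have f_ortho mu : sdominated mu la -> jack_dot al f (P mu) = 0.
  move=> mu_la; rewrite jack_dotBl jack_dotZl (hP.1 la mu); last first.
    by move=> E; case: mu_la => _; apply.
  have [c' ->] := rect_sym_dot N k; first by rewrite P_rank // !mulr0 subrr.
  move=> s /hasP[r rs lt_r]; rewrite -hseq_to_part; apply/eqP/negPn/negP.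
  move=> /(jack_coef_dominated al_gt0 hP) s_mu.
  have /dominated_rect_le : dominated (to_part s) la by exact: dominated_trans mu_la.1.
  move=> /(_ r); rewrite mem_sort mem_filter rs -lt0n (leq_ltn_trans _ lt_r) //.
  by move=> /(_ isT); rewrite leqNgt lt_r.
apply: (jack_dot_definite al_gt0).
exact: (ortho_below al_gt0 hP f_ortho).
Qed.

End Identification.

(** * The value on the opposite alphabet *)
Section Letters.
Variables (A : comAlgType rat) (n : nat) (x : 'I_n -> A).

Definition subst_letters (p : mpoly n rat) : A := mpoly.mmap (in_alg A) x p.

Fact subst_letters_is_linear : linear subst_letters.
Proof. by move=> c p q; rewrite /subst_letters mpoly.mmapD mpoly.mmapZ mulr_algl. Qed.

Fact subst_letters_is_multiplicative : multiplicative subst_letters.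
Proof. exact: mpoly.mmap_is_multiplicative. Qed.

HB.instance Definition _ :=
  GRing.isLinear.Build rat (mpoly n rat) A _ subst_letters subst_letters_is_linear.
HB.instance Definition _ :=
  GRing.isMultiplicative.Build (mpoly n rat) A subst_letters subst_letters_is_multiplicative.

Lemma subst_lettersX i : subst_letters 'X_i = x i.
Proof. by rewrite /subst_letters mpoly.mmapX mmap1U. Qed.

Lemma subst_letters_pairs k :
  subst_letters (\prod_i \prod_(j in setT :\ i) ('X_j - 'X_i) ^+ k)
    = \prod_i \prod_(j in setT :\ i) (x j - x i) ^+ k.
Proof.
rewrite rmorph_prod; apply: eq_bigr => i _; rewrite rmorph_prod; apply: eq_bigr => j _.
by rewrite rmorphXn rmorphB /= !subst_lettersX.
Qed.

Lemma prod_sign : \prod_(i < n) \prod_(j < n | (i < j)%N) (-1 : A) = (-1) ^+ 'C(n, 2).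
Proof.
rewrite (exchange_big_dep xpredT) //= -bin2_sum big_mkord -prodrXr.
apply: eq_bigr => j _.
by rewrite -(big_ord_widen n (fun=> -1)) ?prodr_const ?card_ord // ltnW.
Qed.

(** Each pair of letters occurs twice, with opposite signs. *)
Lemma prod_pairs_vandermonde :
  \prod_i \prod_(j in setT :\ i) (x j - x i) = (-1) ^+ 'C(n, 2) * vandermonde x ^+ 2.
Proof.
rewrite (eq_bigr (fun i : 'I_n => (\prod_(j < n | (i < j)%N) (x j - x i)) *
    \prod_(j < n | (j < i)%N) (x j - x i))) => [|i _]; last first.
  rewrite (bigID (fun j : 'I_n => (i < j)%N)) /=; congr (_ * _); apply: eq_bigl => j.
    by rewrite !inE andbT -val_eqE neq_ltn; case: ltngtP.
  by rewrite !inE andbT -val_eqE neq_ltn -leqNgt; case: ltngtP.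
rewrite big_split /= expr2 mulrA -prod_sign; congr (_ * _); last first.
  by rewrite (exchange_big_dep xpredT).
rewrite /vandermonde -big_split; apply: eq_bigr => i _ /=.
by rewrite -big_split; apply: eq_bigr => j _ /=; rewrite mulN1r opprB.
Qed.

End Letters.

(** On the opposite alphabet the signed elementary functions become the
    complete functions. *)
Lemma sf_eval_neg_rect_sym (A : comAlgType rat) N k (x : 'I_N.+1 -> A) :
  sf_eval_neg x (rect_sym N k) =
    (N.+1)`!%:R * ((-1) ^+ ('C(N.+1, 2) * k) * vandermonde x ^+ (2 * k)).
Proof.
have E (B C : comAlgType rat) (f : {lrmorphism B -> C}) (c : 'I_N.+1 -> nat -> B) (p : nat -> C) :
    (forall i e, f (c i e) = shift (newton p) N e) ->
    f (disc_subst k c) = disc_subst k (fun _ : 'I_N.+1 => shift (newton p) N).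
  move=> cE; rewrite disc_subst_morph; apply: eq_bigr => m _; congr (_ *: _).
  by apply: eq_bigr => i _; rewrite cE.
have <- : subst_letters x (disc_subst k (fun _ : 'I_N.+1 =>
    shift (newton (fun r => \sum_(i < N.+1) ('X_i : mpoly N.+1 rat) ^+ r)) N)) =
    sf_eval_neg x (rect_sym N k).
  rewrite (E _ _ _ _ (powersum x)) => [|_ e]; last first.
    rewrite /shift; case: ifP => _; last exact: raddf0.
    rewrite newton_morph; apply: eq_newton => r; rewrite rmorph_sum; apply: eq_bigr => i _.
    by rewrite rmorphXn /= subst_lettersX.
  rewrite /sf_eval_neg /rect_sym (E _ _ _ _ (powersum x)) // => _ e.
  rewrite /shift; case: ifP => _; last exact: raddf0.
  rewrite newton_morph; apply: eq_newton => r.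
  by rewrite /= linearZ /= psi_subst_psum scaleN1r opprK.
rewrite -[N in shift _ N]/(N.+1.-1) disc_subst_complete // rmorphM rmorph_nat /=.
rewrite subst_letters_pairs !exprM -exprMn -prod_pairs_vandermonde -prodrXl.
by congr (_ * _); apply: eq_bigr => i _; rewrite prodrXl.
Qed.

Theorem corollary5p5 (n k : nat) (hn : (1 <= n)%N) (hk : (1 <= k)%N)
    (P : intpart -> symfun) (hP : is_jack k.+1%:R P)
    (A : comAlgType rat) (x : 'I_n -> A) :
  vandermonde x ^+ (2 * k) =
    ((-1) ^+ ((k * n * (n - 1)) %/ 2)%N / n`!%:R * multinom_coef n k)
      *: sf_eval_neg x (P (rect_part n k)).
Proof.
case: n hn x => // N _ x; set v := vandermonde x ^+ _.
have := congr1 (sf_eval_neg x) (rect_sym_jack N hP).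
rewrite sf_eval_neg_rect_sym -/v /sf_eval_neg linearZ /= -/(sf_eval_neg x _).
have -> : ((k * N.+1 * (N.+1 - 1)) %/ 2 = 'C(N.+1, 2) * k)%N.
  have := mul_bin_diag N.+1 1; rewrite bin1 subn1 /= => E.
  by rewrite -mulnA E mulnCA mulKn // mulnC.
set e := ('C(N.+1, 2) * k)%N; set y := sf_eval_neg x _.
have -> : multinom_coef N.+1 k = (N.+1 * k.+1)`!%:R / (k.+1)`!%:R ^+ N.+1.
  by rewrite /multinom_coef mulnC.
set c := _ / _ => E.
rewrite -scalerA -E mulr_natl -scaler_nat scalerA divfK; last first.
  by rewrite pnatr_eq0 -lt0n fact_gt0.
rewrite -!(signr_odd _ e); case: (odd e); rewrite ?expr0 ?expr1 ?scale1r ?mul1r //.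
by rewrite scaleN1r mulN1r opprK.
Qed.
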